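(* Let $H$ be a complex Hilbert space and $A\subset B(H)$ a $^*$-subalgebra. The following are equivalent. (1) Every self-adjoint operator in $A$ has finite spectrum (equivalently, for every $x\in A$ there is $y\in A$ with $xyx=x$). (2) Every $^*$-subalgebra of $A$ has a unique C$^*$-norm. (3) For every positive element $a\in A$, the subalgebra of $A$ generated by $a$ has a unique C$^*$-norm. (4) $A$ satisfies property (E$^*$): for any $^*$-subalgebra $B\subset A$, any Hilbert space $K_1$, any $^*$-homomorphism $\pi\colon B\to B(K_1)$ and any vector $v\in K_1$ such that $\pi(B)v$ is dense in $K_1$, there exist a Hilbert space $K_2$, a $^*$-homomorphism $\pi_0\colon A\to B(K_2)$ and a vector $w\in K_2$ such that $\pi_0(A)w$ is dense in $K_2$ and $\langle \pi(x)v,v\rangle=\langle \pi_0(x)w,w\rangle$ for every $x\in B$.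
   Context: A C$^*$-norm on a $^*$-algebra $A$ is a norm with $\lVert xy\rVert\le\lVert x\rVert\lVert y\rVert$ and $\lVert x^*x\rVert=\lVert x\rVert^2$ for all $x,y\in A$; $A$ has a unique C$^*$-norm if there is exactly one such norm. Subalgebras are not assumed closed. A positive element of $A$ means an operator in $A$ that is positive in $B(H)$. $^*$-homomorphisms are linear, multiplicative and $^*$-preserving. *)

(* Defs.v *)
From HB Require Import structures.
From mathcomp Require Import all_boot all_order all_algebra.
From mathcomp Require Import complex.
From mathcomp Require Import reals.
Set Implicit Arguments.
Unset Strict Implicit.
Unset Printing Implicit Defensive.
Import Order.TTheory GRing.Theory Num.Theory.
Local Open Scope ring_scope.

Section OperatorAlgebra.
Variable R : realType.
Local Notation C := (complex R).

Definition hnorm_of (V : lmodType C) (ip : V -> V -> C) (u : V) : R :=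
  Num.sqrt (complex.Re (ip u u)).

Definition is_hilbert (V : lmodType C) (ip : V -> V -> C) : Prop :=
  [/\ (forall (a : C) (u v w : V), ip (a *: u + v) w = a * ip u w + ip v w),
      (forall u v : V, ip u v = conjc (ip v u)),
      (forall u : V, 0 <= ip u u),
      (forall u : V, ip u u = 0 -> u = 0) &
      (forall s : nat -> V,
         (forall e : R, 0 < e -> exists N : nat, forall m n : nat,
            (N <= m)%N -> (N <= n)%N -> hnorm_of ip (s m - s n) < e) ->
         exists l : V, forall e : R, 0 < e -> exists N : nat, forall n : nat,
            (N <= n)%N -> hnorm_of ip (s n - l) < e)].

Record hilbert := Hilbert {
  hcar :> lmodType C;
  hip : hcar -> hcar -> C;
  hilbertP : is_hilbert hip }.

Section OnHilbert.
Variable H : hilbert.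

Definition hnorm (u : H) : R := hnorm_of (@hip H) u.

Definition lin_op (x : H -> H) : Prop :=
  forall (a : C) (u v : H), x (a *: u + v) = a *: x u + x v.

Definition bop (x : H -> H) : Prop :=
  lin_op x /\ exists M : R, forall u : H, hnorm (x u) <= M * hnorm u.

Definition adj_of (x y : H -> H) : Prop :=
  forall u v : H, hip (x u) v = hip u (y v).

Definition zero_op : H -> H := fun _ => 0.
Definition add_op (x y : H -> H) : H -> H := fun u => x u + y u.
Definition scale_op (c : C) (x : H -> H) : H -> H := fun u => c *: x u.
Definition mul_op (x y : H -> H) : H -> H := fun u => x (y u).

(* (not necessarily closed, not necessarily unital) subalgebra of B(H) *)
Definition subalg (A : (H -> H) -> Prop) : Prop :=
  [/\ (forall x, A x -> bop x),
      A zero_op,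
      (forall x y, A x -> A y -> A (add_op x y)),
      (forall c x, A x -> A (scale_op c x)) &
      (forall x y, A x -> A y -> A (mul_op x y))].

Definition star_subalg (A : (H -> H) -> Prop) : Prop :=
  subalg A /\ (forall x, A x -> exists2 y, A y & adj_of x y).

Definition cstar_norm (B : (H -> H) -> Prop) (N : (H -> H) -> R) : Prop :=
  (forall x, B x -> 0 <= N x) /\
  [/\ (forall x, B x -> N x = 0 -> x = zero_op),
      (forall x y, B x -> B y -> N (add_op x y) <= N x + N y),
      (forall c x, B x -> N (scale_op c x) = ComplexField.Normc.normc c * N x),
      (forall x y, B x -> B y -> N (mul_op x y) <= N x * N y) &
      (forall x y, B x -> B y -> adj_of x y -> N (mul_op y x) = N x ^+ 2)].

Definition unique_cstar_norm (B : (H -> H) -> Prop) : Prop :=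
  (exists N, cstar_norm B N) /\
  forall N1 N2, cstar_norm B N1 -> cstar_norm B N2 -> forall x, B x -> N1 x = N2 x.

Definition in_spectrum (x : H -> H) (l : C) : Prop :=
  ~ exists S : H -> H, [/\ bop S,
       (forall u, S (x u - l *: u) = u) &
       (forall u, x (S u) - l *: S u = u)].

Definition finite_spectrum (x : H -> H) : Prop :=
  exists s : seq C, forall l, in_spectrum x l -> l \in s.

Definition self_adjoint (x : H -> H) : Prop := adj_of x x.

Definition positive_op (a : H -> H) : Prop := forall u : H, 0 <= hip (a u) u.

Definition gen_subalg (a : H -> H) : (H -> H) -> Prop :=
  fun x => forall S, subalg S -> S a -> S x.

End OnHilbert.

Definition star_hom (H K : hilbert) (B : (H -> H) -> Prop)
    (pi : (H -> H) -> (K -> K)) : Prop :=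
  [/\ (forall x, B x -> bop (pi x)),
      (forall x y, B x -> B y -> pi (add_op x y) = add_op (pi x) (pi y)),
      (forall c x, B x -> pi (scale_op c x) = scale_op c (pi x)),
      (forall x y, B x -> B y -> pi (mul_op x y) = mul_op (pi x) (pi y)) &
      (forall x y, B x -> B y -> adj_of x y -> adj_of (pi x) (pi y))].

Definition cyclic_vec (H K : hilbert) (B : (H -> H) -> Prop)
    (pi : (H -> H) -> (K -> K)) (v : K) : Prop :=
  forall (u : K) (e : R), 0 < e -> exists2 x, B x & hnorm (pi x v - u) < e.

Definition property_Estar (H : hilbert) (A : (H -> H) -> Prop) : Prop :=
  forall B : (H -> H) -> Prop, star_subalg B -> (forall x, B x -> A x) ->
  forall (K1 : hilbert) (pi : (H -> H) -> (K1 -> K1)) (v : K1),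
    star_hom B pi -> cyclic_vec B pi v ->
    exists (K2 : hilbert) (pi0 : (H -> H) -> (K2 -> K2)) (w : K2),
      [/\ star_hom A pi0, cyclic_vec A pi0 w &
          forall x, B x -> hip (pi x v) v = hip (pi0 x w) w].

End OperatorAlgebra.

(* Main.v *)
(* Everything goes through one condition: every self-adjoint [a] in [A] is
   algebraic, i.e. killed by a nonzero polynomial.

   - (1) and algebraicity: [|q(a)|] is an approximate eigenvalue of [q(a)] up to
     sign for real [q], so a [q] vanishing on a finite spectrum kills [a].
   - (1') implies algebraicity: if [c = a (a - m)] has a quasi-inverse, then [m]
     is isolated in the approximate point spectrum of [a], up to the point [0];
     a bounded set without accumulation points is finite.
   - Algebraicity implies (1'), (2) and the positivity needed for (4): a
     polynomial in [a] is determined by its values at the eigenvalues, so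
     [0 <= T - x] can be written [(sqrt T + h)^2] with [h] a polynomial in [x]
     without constant term, hence in the given, possibly non-unital, algebra.
   - If [a] is not algebraic, neither is [c = a^2]; then [p(c) |-> p] identifies
     the algebra generated by [c] with polynomials without constant term, where
     the sup norms on [[0,1]] and [[0,2]] are distinct C*-norms, against (3),
     and evaluation at [-1] is a character that cannot come from a
     representation in which [a^2] is positive, against (4).
   - Algebraicity implies (4): the state of [B] is dominated by the upper
     numerical bound, hence extends to [A] by Hahn-Banach, and the extension is
     represented by the Gelfand-Naimark-Segal construction. *)
Require Import Defs.
From HB Require Import structures.
From mathcomp Require Import all_boot all_order all_algebra.
From mathcomp Require Import complex.
From mathcomp Require Import reals.
From mathcomp Require Import boolp classical_sets functions ring lra.
Import Order.TTheory GRing.Theory Num.Theory.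
Local Open Scope ring_scope.
Set Implicit Arguments.
Unset Strict Implicit.
Unset Printing Implicit Defensive.

(** What shapes the proof is that [A] is neither closed nor unital: there is no continuous
    functional calculus, no identity and no spectral projection to start from. Functions of an
    algebraic operator are obtained by interpolation, and an extra node 0 with value 0 keeps them in
    the algebra. Identities that would involve 1 are rewritten without it: in
    [T - x = (sqrt T + h)^2] the scalars [T] cancel, and the cyclic vector, normally the class of 1,
    becomes an antilinear functional, bounded because every element has its own contractive left
    unit. The completion is a space of functionals, so null vectors need no quotient and limits are
    pointwise. The operator [a^2] serves (3) and (4) alike: it is positive, and it is a product
    taken in [A], which fixes its sign in every representation of [A] but not in those of the
    algebra it generates. *)

Local Notation normc := ComplexField.Normc.normc.
Local Notation "x %:C" := (real_complex _ x) (format "x %:C") : ring_scope.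

(** * Complex numbers and semi-inner products *)

Section ComplexModulus.
Variable R : realType.
Local Notation C := (complex R).
Implicit Types (x y : C) (a b c : R).

Lemma normc_ge0 x : 0 <= normc x.
Proof. by case: x => a b; apply: sqrtr_ge0. Qed.

Lemma normc_real a : normc a%:C = `|a|.
Proof. by rewrite /= expr0n addr0 sqrtr_sqr. Qed.

Lemma normc_sqr x : normc x ^+ 2 = complex.Re x ^+ 2 + complex.Im x ^+ 2.
Proof. by case: x => a b /=; rewrite sqr_sqrtr // addr_ge0 ?sqr_ge0. Qed.

Lemma normc_conj x : normc (conjc x) = normc x.
Proof. by case: x => a b /=; rewrite sqrrN. Qed.

Lemma ler_Re_normc x : complex.Re x <= normc x.
Proof.
apply: le_trans (ler_norm _) _; rewrite -ler_sqr ?nnegrE ?normc_ge0 //.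
by rewrite normc_sqr real_normK ?num_real // lerDl sqr_ge0.
Qed.

Lemma normc_Im x : `|complex.Im x| <= normc x.
Proof.
rewrite -ler_sqr ?nnegrE ?normc_ge0 // normc_sqr real_normK ?num_real //.
by rewrite lerDr sqr_ge0.
Qed.

Lemma normc_Re x : `|complex.Re x| <= normc x.
Proof.
rewrite -ler_sqr ?nnegrE ?normc_ge0 // normc_sqr real_normK ?num_real //.
by rewrite lerDl sqr_ge0.
Qed.

Lemma normc_le_ReIm x : normc x <= `|complex.Re x| + `|complex.Im x|.
Proof.
rewrite -ler_sqr ?nnegrE ?normc_ge0 ?addr_ge0 // normc_sqr sqrrD.
rewrite !real_normK ?num_real // addrAC lerDl mulrn_wge0 //.
by rewrite mulr_ge0.
Qed.

Lemma mulcJ x : x * conjc x = (normc x ^+ 2)%:C.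
Proof.
by rewrite normc_sqr; case: x => a b; simpc; congr Complex; ring.
Qed.

Lemma ReD x y : complex.Re (x + y) = complex.Re x + complex.Re y.
Proof. by case: x y => a b []. Qed.
Lemma ImD x y : complex.Im (x + y) = complex.Im x + complex.Im y.
Proof. by case: x y => a b []. Qed.
Lemma ReN x : complex.Re (- x) = - complex.Re x.
Proof. by case: x. Qed.
Lemma ImN x : complex.Im (- x) = - complex.Im x.
Proof. by case: x. Qed.
Lemma ReMr a x : complex.Re (a%:C * x) = a * complex.Re x.
Proof. by case: x => b c; simpc. Qed.
Lemma ImMr a x : complex.Im (a%:C * x) = a * complex.Im x.
Proof. by case: x => b c; simpc. Qed.
Lemma Re_conj x : complex.Re (conjc x) = complex.Re x.
Proof. by case: x. Qed.
Lemma conjcN1 : conjc (-1) = -1 :> C.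
Proof. by rewrite rmorphN; congr (- _); apply: conjc1. Qed.

(** Rotating by a phase upgrades bounds on real parts to bounds on moduli. *)
Lemma complex_phase x : exists2 z : C, normc z = 1 & z * x = (normc x)%:C.
Proof.
have [->|x0] := eqVneq x 0.
  by exists 1; rewrite ?ComplexField.Normc.normc1 // mulr0 ComplexField.Normc.normc0.
have nx0 : normc x != 0 by apply: contra x0 => /eqP/ComplexField.Normc.eq0_normc ->.
exists ((normc x)^-1%:C * conjc x).
  by rewrite ComplexField.Normc.normcM normc_real normc_conj ger0_norm ?invr_ge0 ?normc_ge0 // mulVf.
by rewrite -mulrA (mulrC _ x) mulcJ -rmorphM expr2 mulKf.
Qed.

Lemma discriminant_le a b c : 0 <= a -> 0 <= c ->
  (forall t : R, 0 <= a + 2 * b * t + c * t ^+ 2) -> b ^+ 2 <= a * c.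
Proof.
move=> a0 c0 h; have [c00|cn0] := eqVneq c 0.
  have [->|b0] := eqVneq b 0; first by rewrite expr0n mulr_ge0.
  (* For [c = 0] and [b != 0] the affine function takes the value -1 here; otherwise the minimum
     [- b / c] is used. *)
  have := h (- (a + 1) / (2 * b)).
  have -> : a + 2 * b * (- (a + 1) / (2 * b)) + c * (- (a + 1) / (2 * b)) ^+ 2 = -1.
    by rewrite c00; field.
  by lra.
have := h (- b / c).
have -> : a + 2 * b * (- b / c) + c * (- b / c) ^+ 2 = (a * c - b ^+ 2) / c by field.
have cp : 0 < c by rewrite lt_neqAle eq_sym cn0.
by rewrite pmulr_lge0 ?invr_gt0 // subr_ge0.
Qed.

End ComplexModulus.

Section SemiInnerProduct.
Variables (R : realType) (V : lmodType (complex R)) (ip : V -> V -> complex R).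
Local Notation C := (complex R).

(** Neither definite nor complete, so as to cover both [hip] and the possibly degenerate
    [gns_form]. *)
Definition semi_inner : Prop :=
  [/\ (forall (a : C) (u v w : V), ip (a *: u + v) w = a * ip u w + ip v w),
      (forall u v : V, ip u v = conjc (ip v u)) &
      (forall u : V, 0 <= ip u u)].

Hypothesis ipP : semi_inner.
Local Notation nrm := (hnorm_of ip).
Implicit Types (u v w : V) (c : C).

Lemma ipDl u v w : ip (u + v) w = ip u w + ip v w.
Proof. by case: ipP => h _ _; rewrite -[u]scale1r h mul1r scale1r. Qed.
Lemma ip0l w : ip 0 w = 0.
Proof. by apply: (addrI (ip 0 w)); rewrite -ipDl !addr0. Qed.
Lemma ipZl c u w : ip (c *: u) w = c * ip u w.
Proof. by case: ipP => h _ _; rewrite -[_ *: _]addr0 h ip0l addr0. Qed.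
Lemma ipNl u w : ip (- u) w = - ip u w.
Proof. by rewrite -scaleN1r ipZl mulN1r. Qed.
Lemma ipBl u v w : ip (u - v) w = ip u w - ip v w.
Proof. by rewrite ipDl ipNl. Qed.
Lemma ipC u v : ip u v = conjc (ip v u). Proof. by case: ipP. Qed.
Lemma ipDr u v w : ip w (u + v) = ip w u + ip w v.
Proof. by rewrite ipC ipDl rmorphD /= -!ipC. Qed.
Lemma ipZr c u w : ip w (c *: u) = conjc c * ip w u.
Proof. by rewrite ipC ipZl rmorphM /= -ipC. Qed.
Lemma ip0r w : ip w 0 = 0.
Proof. by rewrite ipC ip0l rmorph0. Qed.
Lemma ipNr u w : ip w (- u) = - ip w u.
Proof. by rewrite ipC ipNl rmorphN /= -ipC. Qed.
Lemma ipBr u v w : ip w (u - v) = ip w u - ip w v.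
Proof. by rewrite ipDr ipNr. Qed.

Lemma Re_ip_ge0 u : 0 <= complex.Re (ip u u).
Proof. by case: ipP => _ _ /(_ u); rewrite lecE /= => /andP[]. Qed.
Lemma Im_ip u : complex.Im (ip u u) = 0.
Proof. by case: ipP => _ _ /(_ u); rewrite lecE /= => /andP[/eqP]. Qed.
Lemma nrm_ge0 u : 0 <= nrm u. Proof. exact: sqrtr_ge0. Qed.
Lemma nrm_sqr u : nrm u ^+ 2 = complex.Re (ip u u).
Proof. by rewrite sqr_sqrtr ?Re_ip_ge0. Qed.
Lemma ip_nrm u : ip u u = (nrm u ^+ 2)%:C.
Proof.
by rewrite nrm_sqr; move: (Im_ip u); case: (ip u u) => a b /= ->.
Qed.

Lemma Re_ipC u v : complex.Re (ip u v) = complex.Re (ip v u).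
Proof. by rewrite ipC Re_conj. Qed.

Lemma nrm_sqrD u v :
  nrm (u + v) ^+ 2 = nrm u ^+ 2 + 2 * complex.Re (ip u v) + nrm v ^+ 2.
Proof.
rewrite !nrm_sqr ipDl !ipDr !ReD (Re_ipC v u); ring.
Qed.

Lemma nrmZ c u : nrm (c *: u) = normc c * nrm u.
Proof.
apply: (@pexpIrn _ 2) => //; rewrite ?nnegrE ?mulr_ge0 ?normc_ge0 ?nrm_ge0 //.
by rewrite exprMn !nrm_sqr ipZl ipZr mulrA mulcJ ReMr.
Qed.

Lemma nrm0 : nrm 0 = 0.
Proof. by rewrite -(scale0r 0) nrmZ ComplexField.Normc.normc0 mul0r. Qed.
Lemma nrmN u : nrm (- u) = nrm u.
Proof. by rewrite -scaleN1r nrmZ normcN ComplexField.Normc.normc1 mul1r. Qed.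
Lemma Re_cauchy_schwarz u v : complex.Re (ip u v) <= nrm u * nrm v.
Proof.
apply: le_trans (ler_norm _) _.
rewrite -ler_sqr ?nnegrE ?mulr_ge0 ?nrm_ge0 // real_normK ?num_real //.
rewrite exprMn; apply: discriminant_le; rewrite ?sqr_ge0 // => t.
have := sqr_ge0 (nrm (u + t%:C *: v)).
rewrite nrm_sqrD nrmZ exprMn normc_real ipZr conjc_real ReMr.
by rewrite real_normK ?num_real // mulrA mulrAC -mulrA (mulrC (t ^+ 2)) mulrA.
Qed.

Lemma cauchy_schwarz u v : normc (ip u v) <= nrm u * nrm v.
Proof.
have [z nz hz] := complex_phase (ip u v).
have := Re_cauchy_schwarz (z *: u) v.
by rewrite nrmZ nz mul1r ipZl hz.
Qed.

Lemma nrm_triangle u v : nrm (u + v) <= nrm u + nrm v.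
Proof.
rewrite -ler_sqr ?nnegrE ?addr_ge0 ?nrm_ge0 // nrm_sqrD sqrrD.
have := Re_cauchy_schwarz u v; rewrite -mulr_natl; lra.
Qed.

End SemiInnerProduct.

(** * Polynomials in an operator *)

Section PolynomialCalculus.
Variables (K : comNzRingType) (V : lmodType K) (a : V -> V).

Definition peval (p : {poly K}) (u : V) : V := \sum_(i < size p) p`_i *: iter i a u.

Lemma peval_wide n (p : {poly K}) u : (size p <= n)%N ->
  peval p u = \sum_(i < n) p`_i *: iter i a u.
Proof.
move=> pn; rewrite /peval (big_ord_widen _ (fun i => p`_i *: iter i a u) pn).
rewrite big_mkcond /=; apply: eq_bigr => i _.
by case: ltnP => // /(nth_default 0) ->; rewrite scale0r.
Qed.

Lemma pevalD p q u : peval (p + q) u = peval p u + peval q u.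
Proof.
have le1 : (size (p + q)%R <= maxn (size p) (size q))%N by apply: size_polyD.
rewrite (peval_wide u le1) (peval_wide u (leq_maxl (size p) (size q))).
rewrite (peval_wide u (leq_maxr (size p) (size q))) -big_split /=.
by apply: eq_bigr => i _; rewrite coefD scalerDl.
Qed.

Lemma pevalZ c p u : peval (c *: p) u = c *: peval p u.
Proof.
rewrite (peval_wide u (size_scale_leq c p)) /peval scaler_sumr.
by apply: eq_bigr => i _; rewrite coefZ scalerA.
Qed.

Lemma peval0 u : peval 0 u = 0.
Proof. by rewrite /peval size_poly0 big_ord0. Qed.

Lemma pevalN p u : peval (- p) u = - peval p u.
Proof. by have := pevalZ (-1) p u; rewrite !scaleN1r. Qed.

Lemma pevalB p q u : peval (p - q) u = peval p u - peval q u.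
Proof. by rewrite pevalD pevalN. Qed.

Lemma pevalC c u : peval c%:P u = c *: u.
Proof. by rewrite (peval_wide u (size_polyC_leq1 c)) big_ord1 coefC. Qed.

Lemma peval1 u : peval 1 u = u.
Proof. by rewrite pevalC scale1r. Qed.

Lemma pevalMXr p u : peval (p * 'X) u = peval p (a u).
Proof.
have sz : (size (p * 'X)%R <= (size p).+1)%N.
  by have [->|p0] := eqVneq p 0; rewrite ?mul0r ?size_poly0 // size_mulX.
rewrite (peval_wide u sz) big_ord_recl coefMX scale0r add0r /peval.
by apply: eq_bigr => i _; rewrite coefMX /= -iterSr.
Qed.

Lemma pevalX u : peval 'X u = a u.
Proof. by rewrite -['X]mul1r pevalMXr peval1. Qed.

Hypothesis lin_a : forall c u v, a (c *: u + v) = c *: a u + a v.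

Lemma iter_lin i c u v : iter i a (c *: u + v) = c *: iter i a u + iter i a v.
Proof. by elim: i => //= i ->; rewrite lin_a. Qed.

Lemma peval_lin p c u v : peval p (c *: u + v) = c *: peval p u + peval p v.
Proof.
rewrite /peval scaler_sumr -big_split /=; apply: eq_bigr => i _.
by rewrite iter_lin scalerDr !scalerA mulrC.
Qed.

Lemma peval_comm p u : peval p (a u) = a (peval p u).
Proof.
elim/poly_ind: p u => [|p c IH] u.
  by rewrite !peval0; have := lin_a (-1) 0 0; rewrite scaler0 addr0 scaleN1r addNr.
by rewrite !pevalD !pevalC !pevalMXr IH addrC [in RHS]addrC lin_a -IH.
Qed.

Lemma pevalM p q u : peval (p * q) u = peval p (peval q u).
Proof.
elim/poly_ind: p u => [|p c IH] u; first by rewrite mul0r !peval0.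
rewrite mulrDl pevalD mul_polyC pevalZ -mulrA (mulrC 'X) mulrA pevalMXr IH.
by rewrite pevalD pevalC pevalMXr peval_comm.
Qed.

(** The sum is [peval (a \o a) p u] spelled out, since [peval] is tied to [a] inside this
    section. *)
Lemma peval_comp_sqr p u :
  peval (p \Po 'X^2) u = \sum_(i < size p) p`_i *: iter i (a \o a) u.
Proof.
have itE i v : iter i (a \o a) v = peval ('X^2 ^+ i) v.
  elim: i v => [|i IH] v; first by rewrite expr0 peval1.
  by rewrite exprS pevalM -IH expr2 pevalMXr pevalX.
rewrite comp_polyE; elim/big_rec2: _ => [|i v q _ IH]; first by rewrite peval0.
by rewrite pevalD pevalZ IH itE.
Qed.

End PolynomialCalculus.

Lemma poly0_exists (K : comNzRingType) (p : {poly K}) : p`_0 = 0 -> exists q, p = q * 'X.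
Proof.
elim/poly_ind: p => [|p c _] h; first by exists 0; rewrite mul0r.
by move: h; rewrite coefD coefMX add0r coefC /= => ->; exists p; rewrite addr0.
Qed.

Section Interpolation.
Variable K : fieldType.

(** This replaces functional calculus on a finite spectrum. Newton's scheme: a multiple of the
    product over the old nodes corrects the value at the new one. *)
Lemma interpolation (s : seq K) (f : K -> K) :
  exists g : {poly K}, forall l, l \in s -> g.[l] = f l.
Proof.
elim: s => [|l s [g hg]]; first by exists 0.
have [ls|lns] := boolP (l \in s).
  by exists g => m; rewrite inE => /predU1P[->|]; apply: hg.
pose w := \prod_(z <- s) ('X - z%:P).
have w0 : w.[l] != 0.
  by apply: contra lns => h; rewrite -root_prod_XsubC.
exists (g + ((f l - g.[l]) / w.[l]) *: w) => m; rewrite inE hornerD hornerZ.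
move=> /predU1P[->|ms]; first by rewrite divfK // addrC subrK.
have -> : w.[m] = 0 by apply/eqP; rewrite -/(root w m) root_prod_XsubC.
by rewrite mulr0 addr0 hg.
Qed.

End Interpolation.

(** * Operators on a Hilbert space *)

Section Operators.
Variables (R : realType) (H : hilbert R).
Local Notation C := (complex R).
Local Notation nrm := (@hnorm R H).
Implicit Types (x y z : H -> H) (u v w : H) (A B : (H -> H) -> Prop).

Lemma hilbert_semi : semi_inner (@hip R H).
Proof. by case: (hilbertP H) => h1 h2 h3 h4 _; split. Qed.
Let HP := hilbert_semi.

Lemma hnorm_ge0 u : 0 <= nrm u. Proof. exact: nrm_ge0. Qed.
Lemma hnorm0 : nrm 0 = 0. Proof. exact: nrm0 HP. Qed.
Lemma hnormZ c u : nrm (c *: u) = normc c * nrm u. Proof. exact: nrmZ HP c u. Qed.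
Lemma hnormN u : nrm (- u) = nrm u. Proof. exact: nrmN HP u. Qed.
Lemma hnorm_triangle u v : nrm (u + v) <= nrm u + nrm v.
Proof. exact: nrm_triangle HP u v. Qed.
Lemma hnorm_sqr u : nrm u ^+ 2 = complex.Re (hip u u).
Proof. exact: nrm_sqr HP u. Qed.

Lemma hip_eq0 u : (forall v, hip u v = 0) -> u = 0.
Proof. by case: (hilbertP H) => _ _ _ h _ hu; apply: h. Qed.

Lemma hip_inj u v : (forall w, hip u w = hip v w) -> u = v.
Proof.
move=> h; apply/eqP; rewrite -subr_eq0; apply/eqP/hip_eq0 => w.
by rewrite (ipBl HP) h subrr.
Qed.

Lemma hnorm_eq0 u : nrm u = 0 -> u = 0.
Proof.
case: (hilbertP H) => _ _ _ h _ hu; apply: h.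
by rewrite (ip_nrm HP) -/(hnorm u) hu expr0n.
Qed.

Lemma hnorm_gt0 u : u <> 0 -> 0 < nrm u.
Proof.
by move=> u0; rewrite lt_neqAle hnorm_ge0 andbT eq_sym; apply/eqP => /hnorm_eq0.
Qed.

Section Linear.
Variables (x : H -> H) (lx : lin_op x).
Lemma lin0 : x 0 = 0.
Proof. by have := lx (-1) 0 0; rewrite scaler0 addr0 scaleN1r addNr. Qed.
Lemma linD u v : x (u + v) = x u + x v.
Proof. by rewrite -[u]scale1r lx !scale1r. Qed.
Lemma linZ c u : x (c *: u) = c *: x u.
Proof. by rewrite -[_ *: u]addr0 lx lin0 addr0. Qed.
Lemma linN u : x (- u) = - x u.
Proof. by rewrite -scaleN1r linZ scaleN1r. Qed.
Lemma linB u v : x (u - v) = x u - x v.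
Proof. by rewrite linD linN. Qed.
End Linear.

Lemma adj_lin x y : adj_of x y -> lin_op x.
Proof.
move=> xy c u v; apply: hip_inj => w.
by rewrite xy !(ipDl HP) !(ipZl HP) !xy.
Qed.

Lemma adj_sym x y : adj_of x y -> adj_of y x.
Proof. by move=> xy u v; rewrite (ipC HP) -xy -(ipC HP). Qed.

Lemma adj_unique x y z : adj_of x y -> adj_of x z -> y = z.
Proof.
move=> xy xz; apply/funext => u; apply: hip_inj => w.
by rewrite (adj_sym xy) (adj_sym xz).
Qed.

Lemma adj_add x x' y y' : adj_of x x' -> adj_of y y' ->
  adj_of (add_op x y) (add_op x' y').
Proof. by move=> hx hy u v; rewrite /add_op (ipDl HP) (ipDr HP) hx hy. Qed.

Lemma adj_scale c x x' : adj_of x x' -> adj_of (scale_op c x) (scale_op (conjc c) x').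
Proof. by move=> hx u v; rewrite /scale_op (ipZl HP) (ipZr HP) conjcK hx. Qed.

Lemma adj_mul x x' y y' : adj_of x x' -> adj_of y y' ->
  adj_of (mul_op x y) (mul_op y' x').
Proof. by move=> hx hy u v; rewrite /mul_op hx hy. Qed.

Lemma adj_mul_self x x' : adj_of x x' -> self_adjoint (mul_op x' x).
Proof. by move=> h; apply: adj_mul => //; apply: adj_sym. Qed.

Lemma adj_nrm_sqr x x' u : adj_of x x' -> hip (x' (x u)) u = (nrm (x u) ^+ 2)%:C.
Proof. by move=> h; rewrite (adj_sym h) (ip_nrm HP). Qed.

Lemma self_adjoint_sqr_eq0 x u : self_adjoint x -> x (x u) = 0 -> x u = 0.
Proof.
move=> h h0; apply: hnorm_eq0; apply/eqP; rewrite -sqrf_eq0; apply/eqP.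
by apply: (@complexI R); rewrite -(adj_nrm_sqr u h) h0 (ip0l HP).
Qed.

Lemma self_adjoint_Im x u : self_adjoint x -> complex.Im (hip (x u) u) = 0.
Proof.
move=> h; have : hip (x u) u = conjc (hip (x u) u) by rewrite {1}h (ipC HP).
by case: (hip (x u) u) => a b [] /=; lra.
Qed.

(** Polarisation: the form is real on the diagonal, and expanding it at [u + v] and ['i *: u + v]
    gives the sum and the difference of the wanted identity and its mirror image. *)
Lemma positive_self_adjoint x : bop x -> positive_op x -> self_adjoint x.
Proof.
move=> [lx _] px.
have sym u : hip (x u) u = hip u (x u).
  rewrite (ipC HP u); have := px u.
  by case: (hip (x u) u) => p q; rewrite lecE /= => /andP[/eqP-> _]; rewrite oppr0.
have re u v : hip (x u) v + hip (x v) u = hip u (x v) + hip v (x u).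
  have := sym (u + v); rewrite (linD lx) !(ipDl HP) !(ipDr HP) !sym.
  set p := hip u (x u); set q := hip v (x v); set b := hip (x u) v => e.
  have -> : b + hip (x v) u = p + b + (hip (x v) u + q) - p - q by ring.
  by rewrite e; ring.
move=> u v; have e1 := re u v; have := re ('i%C *: u) v.
rewrite !(linZ lx) !(ipZl HP) !(ipZr HP) => e2.
have ci : conjc 'i%C = - 'i%C :> C by simpc.
rewrite ci !mulNr in e2.
have i0 : 'i%C != 0 :> C by rewrite eq_complex /= oner_eq0 andbF.
have e3 : hip (x u) v - hip (x v) u = hip u (x v) - hip v (x u).
  by apply: (mulfI i0); rewrite !mulrBr e2.
have : 2%:R * hip (x u) v = 2%:R * hip u (x v).
  have -> : 2%:R * hip (x u) v = (hip (x u) v + hip (x v) u) + (hip (x u) v - hip (x v) u) by ring.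
  by rewrite e1 e3; ring.
by apply: mulfI; rewrite pnatr_eq0.
Qed.

Lemma mul_self_positive x x' : adj_of x x' -> positive_op (mul_op x' x).
Proof. by move=> h u; rewrite /mul_op (adj_nrm_sqr u h) ler0c sqr_ge0. Qed.

Definition opnorm x : R := inf [set M | 0 <= M /\ forall u, nrm (x u) <= M * nrm u]%classic.

Lemma bop_bound x : bop x -> exists2 M, 0 <= M & forall u, nrm (x u) <= M * nrm u.
Proof.
move=> [_ [M hM]]; exists `|M| => // u; apply: le_trans (hM u) _.
by rewrite ler_wpM2r ?hnorm_ge0 // ler_norm.
Qed.

Lemma opnorm_ge0 x : bop x -> 0 <= opnorm x.
Proof. by move=> /bop_bound[M M0 hM]; apply: lb_le_inf => [|z []//]; exists M. Qed.

Lemma opnorm_le x M : 0 <= M -> (forall u, nrm (x u) <= M * nrm u) -> opnorm x <= M.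
Proof. by move=> M0 hM; apply: ge_inf => //; exists 0 => z []. Qed.

Lemma opnorm_bound x u : bop x -> nrm (x u) <= opnorm x * nrm u.
Proof.
move=> bx; have [M0 M00 hM0] := bop_bound bx.
have [->|u0] := pselect (u = 0).
  by rewrite (lin0 bx.1) hnorm0 mulr0.
rewrite -ler_pdivrMr ?hnorm_gt0 //; apply: lb_le_inf; first by exists M0.
by move=> M [_ hM]; rewrite ler_pdivrMr ?hnorm_gt0.
Qed.

Lemma bop_add x y : bop x -> bop y -> bop (add_op x y).
Proof.
move=> bx by_; split.
  move=> c u v; rewrite /add_op bx.1 by_.1 scalerDr -!addrA; congr (_ + _).
  by rewrite addrCA.
exists (opnorm x + opnorm y) => u; apply: le_trans (hnorm_triangle _ _) _.
by rewrite mulrDl lerD // opnorm_bound.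
Qed.

Lemma bop_scale c x : bop x -> bop (scale_op c x).
Proof.
move=> bx; split.
  by move=> d u v; rewrite /scale_op bx.1 scalerDr !scalerA mulrC.
exists (normc c * opnorm x) => u.
by rewrite hnormZ -mulrA ler_wpM2l ?normc_ge0 // opnorm_bound.
Qed.

Lemma bop_mul x y : bop x -> bop y -> bop (mul_op x y).
Proof.
move=> bx by_; split; first by move=> d u v; rewrite /mul_op by_.1 bx.1.
exists (opnorm x * opnorm y) => u; apply: le_trans (opnorm_bound _ bx) _.
by rewrite -mulrA ler_wpM2l ?opnorm_ge0 // opnorm_bound.
Qed.

Lemma bop_zero : bop (@zero_op R H).
Proof.
split=> [c u v|]; first by rewrite /zero_op scaler0 addr0.
by exists 0 => u; rewrite /zero_op mul0r hnorm0.
Qed.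

Lemma bop_id : bop (fun u : H => u).
Proof. by split=> //; exists 1 => u; rewrite mul1r. Qed.

Lemma adj_opnorm_le x y : adj_of x y -> bop x -> bop y -> opnorm y <= opnorm x.
Proof.
move=> xy bx by_; apply: opnorm_le; rewrite ?opnorm_ge0 // => u.
have [->|u0] := eqVneq (nrm (y u)) 0.
  by rewrite mulr_ge0 ?opnorm_ge0 ?hnorm_ge0.
have yp : 0 < nrm (y u) by rewrite lt_neqAle eq_sym u0 hnorm_ge0.
rewrite -(ler_pM2r yp) -expr2 hnorm_sqr -xy.
apply: le_trans (Re_cauchy_schwarz HP _ _) _.
by rewrite mulrAC ler_wpM2r ?hnorm_ge0 // opnorm_bound.
Qed.

Lemma opnorm_cstar B : star_subalg B -> cstar_norm B opnorm.
Proof.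
move=> [[bB B0 BD BZ BM] Bs].
split; first by move=> x /bB; apply: opnorm_ge0.
split.
- move=> x /bB bx h; apply/funext => u; apply: hnorm_eq0; apply/eqP.
  by rewrite eq_le hnorm_ge0 andbT -(mul0r (nrm u)) -h opnorm_bound.
- move=> x y /bB bx /bB by_; apply: opnorm_le; rewrite ?addr_ge0 ?opnorm_ge0 // => u.
  by apply: le_trans (hnorm_triangle _ _) _; rewrite mulrDl lerD // opnorm_bound.
- have le c x : B x -> opnorm (scale_op c x) <= normc c * opnorm x.
    move=> /bB bx; apply: opnorm_le => [|u]; rewrite ?mulr_ge0 ?normc_ge0 ?opnorm_ge0 //.
    by rewrite hnormZ -mulrA ler_wpM2l ?normc_ge0 // opnorm_bound.
  move=> c x Bx; apply/eqP; rewrite eq_le le //=.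
  have [->|c0] := eqVneq c 0.
    by rewrite ComplexField.Normc.normc0 mul0r opnorm_ge0 //; apply: bop_scale (bB _ Bx).
  have nc : 0 < normc c.
    rewrite lt_neqAle normc_ge0 andbT eq_sym; apply: contra c0 => /eqP.
    by move=> /ComplexField.Normc.eq0_normc ->.
  rewrite mulrC -ler_pdivlMr // mulrC -ComplexField.Normc.normcV.
  have {1}-> : x = scale_op c^-1 (scale_op c x).
    by apply/funext => u; rewrite /scale_op scalerA mulVf // scale1r.
  by apply: le; apply: BZ.
- move=> x y /bB bx /bB by_; apply: opnorm_le; rewrite ?mulr_ge0 ?opnorm_ge0 // => u.
  apply: le_trans (opnorm_bound _ bx) _.
  by rewrite -mulrA ler_wpM2l ?opnorm_ge0 // opnorm_bound.
- move=> x y Bx By xy; have bx := bB _ Bx; have by_ := bB _ By.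
  have byx := bop_mul by_ bx.
  apply/eqP; rewrite eq_le; apply/andP; split.
    apply: opnorm_le; rewrite ?sqr_ge0 // => u.
    apply: le_trans (opnorm_bound _ by_) _.
    rewrite expr2 -mulrA; apply: ler_pM; rewrite ?opnorm_ge0 ?hnorm_ge0 //.
      exact: adj_opnorm_le.
    exact: opnorm_bound.
  (* For the reverse inequality this square root is shown to bound [x], as |x u|^2 = <u, y x u>. *)
  have s2 : Num.sqrt (opnorm (mul_op y x)) ^+ 2 = opnorm (mul_op y x).
    by rewrite sqr_sqrtr // opnorm_ge0.
  rewrite -s2 ler_sqr ?nnegrE ?sqrtr_ge0 ?opnorm_ge0 //.
  apply: opnorm_le; rewrite ?sqrtr_ge0 // => u.
  rewrite -ler_sqr ?nnegrE ?mulr_ge0 ?sqrtr_ge0 ?hnorm_ge0 // exprMn s2.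
  rewrite (hnorm_sqr (x u)) xy (Re_ipC HP) expr2 mulrA.
  apply: le_trans (Re_cauchy_schwarz HP _ _) _.
  by rewrite ler_wpM2r ?hnorm_ge0 // (opnorm_bound _ byx).
Qed.

End Operators.

(** * Algebraic self-adjoint operators *)

Section Algebraic.
Variables (R : realType) (H : hilbert R).
Local Notation C := (complex R).
Local Notation nrm := (@hnorm R H).
Local Notation toC := (map_poly (real_complex R)).
Implicit Types (a x y : H -> H) (u v w : H) (A B : (H -> H) -> Prop).
Let HP := hilbert_semi H.

Lemma adj_peval a a' (p : {poly C}) : adj_of a a' ->
  adj_of (peval a p) (peval a' (map_poly conjc p)).
Proof.
move=> aa'; have la := adj_lin aa'; have la' := adj_lin (adj_sym aa').
elim/poly_ind: p => [|p c IH].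
  by move=> u v; rewrite rmorph0 !peval0 (ip0l HP) (ip0r HP).
move=> u v; rewrite rmorphD rmorphM /= map_polyX map_polyC /=.
rewrite !pevalD !pevalC !pevalMXr (ipDl HP) (ipDr HP) (ipZl HP) (ipZr HP) conjcK.
by rewrite IH (peval_comm la') aa'.
Qed.

Lemma self_adjoint_peval a (p : {poly R}) : self_adjoint a -> self_adjoint (peval a (toC p)).
Proof.
move=> sa; have := adj_peval (toC p) sa; rewrite /self_adjoint.
by congr (adj_of _ (peval _ _)); apply/polyP => i; rewrite !coef_map; apply: conjc_real.
Qed.

Lemma bop_peval a (p : {poly C}) : bop a -> bop (peval a p).
Proof.
move=> ba; elim/poly_ind: p => [|p c IH].
  have -> : peval a 0 = @zero_op R H by apply/funext => u; rewrite peval0.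
  exact: bop_zero.
have -> : peval a (p * 'X + c%:P) = add_op (mul_op (peval a p) a) (scale_op c (fun u => u)).
  by apply/funext => u; rewrite pevalD pevalC pevalMXr.
by apply: bop_add; [apply: bop_mul | apply/bop_scale/bop_id].
Qed.

(** The vanishing constant term makes up for the missing unit: only products and multiples of [a]
    occur. *)
Lemma subalg_peval B a (p : {poly C}) : subalg B -> B a -> p`_0 = 0 -> B (peval a p).
Proof.
move=> [bB B0 BD BZ BM] Ba /poly0_exists[q ->] {p}.
have la := (bB _ Ba).1.
elim/poly_ind: q => [|q c IH].
  have -> // : peval a (0 * 'X) = @zero_op R H.
  by apply/funext => u; rewrite mul0r peval0.
have -> : peval a ((q * 'X + c%:P) * 'X) = add_op (mul_op (peval a (q * 'X)) a) (scale_op c a).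
  by apply/funext => u; rewrite pevalMXr pevalD pevalC.
by apply: BD; [apply: BM | apply: BZ].
Qed.

Lemma gen_subalgP a x : bop a ->
  (exists2 p : {poly C}, p`_0 = 0 & x = peval a p) <-> gen_subalg a x.
Proof.
move=> ba; have la := ba.1; split=> [[p p0 ->] S sS Sa|]; first exact: subalg_peval.
move=> /(_ (fun x => exists2 p : {poly C}, p`_0 = 0 & x = peval a p)); apply; last first.
  by exists 'X; [rewrite coefX | apply/funext => u; rewrite pevalX].
split.
- by move=> _ [p _ ->]; apply: bop_peval.
- by exists 0; [rewrite coef0 | apply/funext => u; rewrite peval0].
- move=> _ _ [p p0 ->] [q q0 ->]; exists (p + q); first by rewrite coefD p0 q0 addr0.
  by apply/funext => u; rewrite pevalD.
- move=> c _ [p p0 ->]; exists (c *: p); first by rewrite coefZ p0 mulr0.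
  by apply/funext => u; rewrite pevalZ.
- move=> _ _ [p p0 ->] [q q0 ->]; exists (p * q); first by rewrite coef0M p0 mul0r.
  by apply/funext => u; rewrite (pevalM la).
Qed.

Lemma gen_subalg_star a : bop a -> self_adjoint a -> star_subalg (gen_subalg a).
Proof.
move=> ba sa; split.
  split.
  - by move=> x /(gen_subalgP _ ba)[p _ ->]; apply: bop_peval.
  - by move=> S [].
  - by move=> x y hx hy S sS Sa; case: (sS) => _ _ + _ _; apply; [apply: hx | apply: hy].
  - by move=> c x hx S sS Sa; case: (sS) => _ _ _ + _; apply; apply: hx.
  - by move=> x y hx hy S sS Sa; case: (sS) => _ _ _ _; apply; [apply: hx | apply: hy].
move=> x /(gen_subalgP _ ba)[p p0 ->].
exists (peval a (map_poly conjc p)); last exact: adj_peval.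
by apply/(gen_subalgP _ ba); exists (map_poly conjc p) => //; rewrite coef_map p0; apply: conjc0.
Qed.

Lemma peval_commute a y (p : {poly C}) u : lin_op y ->
  (forall v, y (a v) = a (y v)) -> y (peval a p u) = peval a p (y u).
Proof.
move=> ly ya; elim/poly_ind: p u => [|p c IH] u; first by rewrite !peval0 lin0.
by rewrite !pevalD !pevalC !pevalMXr (linD ly) (linZ ly) IH ya.
Qed.

Definition algebraic a : Prop := exists2 p : {poly C}, p != 0 & forall u, peval a p u = 0.

Lemma peval_XsubC a (z : C) u : lin_op a -> peval a ('X - z%:P) u = a u - z *: u.
Proof. by move=> la; rewrite pevalB pevalX pevalC. Qed.

(** Apply the linear factors one at a time; the last nonzero vector is an eigenvector. Its form
    [peval a m v] makes it commute with further polynomials in [algebraic_spectrum]. *)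
Lemma eigenvector_exists a (r : seq C) v : lin_op a ->
  peval a (\prod_(z <- r) ('X - z%:P)) v = 0 -> v <> 0 ->
  exists2 z : C, z \in r & exists m, let v' := peval a m v in v' <> 0 /\ a v' = z *: v'.
Proof.
move=> la; elim: r => [|z r IH]; first by rewrite big_nil peval1.
rewrite big_cons (pevalM la) (peval_XsubC _ _ la) => hz v0.
have [w0|w0] := pselect (peval a (\prod_(j <- r) ('X - j%:P)) v = 0).
  by have [z' z'r h] := IH w0 v0; exists z' => //; rewrite inE z'r orbT.
exists z; first by rewrite inE eqxx.
by exists (\prod_(j <- r) ('X - j%:P)); split=> //; apply/eqP; rewrite -subr_eq0; apply/eqP.
Qed.

Lemma eigenvalue_real a (z : C) u : self_adjoint a -> u <> 0 -> a u = z *: u -> z = (complex.Re z)%:C.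
Proof.
move=> sa u0 au; have := self_adjoint_Im u sa.
rewrite au (ipZl HP) (ip_nrm HP) mulrC ImMr => /eqP; rewrite mulf_eq0 sqrf_eq0.
case/orP=> [/eqP/hnorm_eq0 //|/eqP]; by case: z {au} => p q /= ->.
Qed.

Lemma self_adjoint_shift a (l : R) : self_adjoint a ->
  self_adjoint (fun u => a u - l%:C *: u).
Proof.
by move=> sa u v; rewrite (ipBl HP) (ipBr HP) (ipZl HP) (ipZr HP) conjc_real sa.
Qed.

(* [s] lists the eigenvalues: as [ker (a - l)^2 = ker (a - l)] for self-adjoint
   [a], a polynomial in [a] only depends on its values on [s]. *)
Lemma algebraic_spectrum a : self_adjoint a -> algebraic a ->
  exists2 s : seq R, (forall l, l \in s -> exists2 u, u <> 0 & a u = l%:C *: u) &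
    forall q : {poly C}, (forall l, l \in s -> q.[l%:C] = 0) -> forall u, peval a q u = 0.
Proof.
move=> sa [p p0 pa]; have la := adj_lin sa.
have [r pr] := closed_field_poly_normal p.
have ra u : peval a (\prod_(z <- r) ('X - z%:P)) u = 0.
  have := pa u; rewrite pr pevalZ => /eqP; rewrite scaler_eq0 lead_coef_eq0.
  by rewrite (negPf p0) => /eqP.
(* Only those roots that are genuine eigenvalues are kept; they are real, so taking real parts loses
   nothing. *)
exists [seq complex.Re z | z <- r & `[< exists2 u, u <> 0 & a u = z *: u >]].
  move=> l /mapP[z]; rewrite mem_filter => /andP[/asboolP[u u0 au] _ ->].
  by exists u => //; rewrite -(eigenvalue_real sa u0 au).
(* If [q(a) u] is nonzero, some [v' = m(a) q(a) u] is an eigenvector for a root [z] of [q]. Then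
   [v'] lies both in the kernel and in the range of [a - z], which meet only in 0. *)
move=> q hq u; apply: contrapT => v0.
have [z zr [m [v'0 av']]] := eigenvector_exists la (ra _) v0.
have zE := eigenvalue_real sa v'0 av'.
have : root q z.
  rewrite /root zE hq //; apply: map_f; rewrite mem_filter zr andbT.
  by apply/asboolP; eexists; [exact: v'0 | exact: av'].
case/factor_theorem=> q' qE; apply: v'0.
have vE : peval a m (peval a q u) = a (peval a (m * q') u) - z *: peval a (m * q') u.
  by rewrite -(pevalM la) qE mulrA [m * q' * _]mulrC [LHS](pevalM la) peval_XsubC.
rewrite vE zE; apply: (self_adjoint_sqr_eq0 (self_adjoint_shift _ sa)).
by rewrite -zE -vE av' subrr.
Qed.

Lemma toC_horner (g : {poly R}) l : (toC g).[l%:C] = (g.[l])%:C.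
Proof. by rewrite horner_map. Qed.

Lemma toC_coef0 (g : {poly R}) : g.[0] = 0 -> (toC g)`_0 = 0.
Proof. by rewrite horner_coef0 coef_map => ->. Qed.

(** Here [h = sqrt (T - x) - sqrt T], a function vanishing at 0, so [h] stays in [B]; the last
    clause is [T - x = (sqrt T + h)^2] with [T] cancelled. The commutation clause is for the use
    with [mul_op x x], whose [h] must commute with [x]. *)
Lemma algebraic_sqrt_shift B x (T : R) : star_subalg B -> B x -> self_adjoint x ->
  algebraic x -> 0 <= T -> (forall u, complex.Re (hip (x u) u) <= T * nrm u ^+ 2) ->
  exists h, [/\ B h, self_adjoint h,
    (forall y, lin_op y -> (forall u, y (x u) = x (y u)) -> forall u, y (h u) = h (y u)) &
    forall u, x u = - ((2 * Num.sqrt T)%:C *: h u + h (h u))].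
Proof.
move=> [sB _] Bx sx ax T0 xT; have lx := adj_lin sx.
have [s es hs] := algebraic_spectrum sx ax.
have [g hg] := interpolation (0 :: s) (fun l => Num.sqrt (T - l) - Num.sqrt T).
have g0 : g.[0] = 0 by rewrite hg ?inE ?eqxx // subr0 subrr.
exists (peval x (toC g)); split.
- by apply: subalg_peval => //; apply: toC_coef0.
- exact: self_adjoint_peval.
- by move=> y ly yx u; apply: peval_commute.
move=> u; apply/eqP; rewrite -addr_eq0 -pevalZ -(pevalM lx) -(pevalX x u) -!pevalD.
apply/eqP; apply: hs => l ls.
(* Testing the hypothesis on an eigenvector makes [T - l] nonnegative, so that its square root is a
   true one. *)
have lT : l <= T.
  have [v v0 xv] := es l ls; have := xT v.
  rewrite xv (ipZl HP) (ip_nrm HP) ReMr /= ler_pM2r // exprn_gt0 //.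
  exact: hnorm_gt0.
rewrite !hornerD hornerZ hornerM hornerX toC_horner -!rmorphM -!rmorphD /=.
rewrite hg ?inE ?ls ?orbT //; set r := Num.sqrt (T - l); set t := Num.sqrt T.
have -> : l + (2 * t * (r - t) + (r - t) * (r - t)) = l + r ^+ 2 - t ^+ 2 by ring.
by rewrite !sqr_sqrtr ?subr_ge0 // addrCA subrr addr0 subrr.
Qed.

(** The witness is the Moore-Penrose inverse [(x' x)^+ x']. As |x v|^2 = <v, x' x v>, it suffices to
    check the equation after multiplying by [x'] on the left. *)
Lemma algebraic_regular A x x' : star_subalg A -> A x -> A x' -> adj_of x x' ->
  algebraic (mul_op x' x) -> exists2 y, A y & mul_op (mul_op x y) x = x.
Proof.
move=> [sA _] Ax Ax' xx' alg; have sa := adj_mul_self xx'.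
have Aa : A (mul_op x' x) by case: sA => _ _ _ _; apply.
have [s _ hs] := algebraic_spectrum sa alg.
have la := adj_lin sa; have lx := adj_lin xx'; have lx' := adj_lin (adj_sym xx').
(* The convention that the inverse of 0 is 0 gives both the pseudo-inverse and the value needed at
   0. *)
have [g hg] := interpolation (0 :: s) (fun l => l^-1).
have g0 : g.[0] = 0 by rewrite hg ?inE ?eqxx // invr0.
pose z := peval (mul_op x' x) (toC g).
have Az : A z by apply: subalg_peval => //; apply: toC_coef0.
exists (mul_op z x'); first by case: sA => _ _ _ _; apply.
apply/funext => u; rewrite /mul_op; apply/eqP; rewrite -subr_eq0; apply/eqP.
rewrite -(linB lx); apply: hnorm_eq0; apply/eqP; rewrite -sqrf_eq0; apply/eqP.
rewrite hnorm_sqr xx' (linB lx) (linB lx').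
suff -> : x' (x (z (x' (x u)))) = x' (x u) by rewrite subrr (ip0r HP).
apply/eqP; rewrite -subr_eq0; apply/eqP.
have -> : x' (x (z (x' (x u)))) - x' (x u) = peval (mul_op x' x) ('X * toC g * 'X - 'X) u.
  by rewrite pevalB pevalX pevalMXr (pevalM la) pevalX.
apply: hs => l ls; rewrite !(hornerD, hornerN, hornerM, hornerX) toC_horner hg ?inE ?ls ?orbT //.
rewrite -!rmorphM -rmorphB /=; have [->|l0] := eqVneq l 0; first by rewrite mulr0 subr0.
by rewrite mulfV // mul1r subrr.
Qed.

(** [e] is the range projection of [y], namely the indicator of the nonzero eigenvalues of [y y'].
    It replaces the unit when the functional [psi] is bounded in [gns]. *)
Lemma algebraic_left_unit A y y' : star_subalg A -> A y -> A y' -> adj_of y y' ->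
  algebraic (mul_op y y') -> exists e, [/\ A e, self_adjoint e, mul_op e y = y &
    forall u, nrm (e u) <= nrm u].
Proof.
move=> [sA _] Ay Ay' yy' alg; have y'y := adj_sym yy'.
have sb : self_adjoint (mul_op y y') by apply: adj_mul_self.
have Ab : A (mul_op y y') by case: sA => _ _ _ _; apply.
have [s _ hs] := algebraic_spectrum sb alg.
have lb := adj_lin sb; have ly' := adj_lin y'y.
have [g hg] := interpolation (0 :: s) (fun l => (l != 0)%:R).
have g0 : g.[0] = 0 by rewrite hg ?inE ?eqxx.
pose e := peval (mul_op y y') (toC g).
have se : self_adjoint e by apply: self_adjoint_peval.
have eb u : e (y (y' u)) = y (y' u).
  apply/eqP; rewrite -subr_eq0; apply/eqP.
  have -> : e (y (y' u)) - y (y' u) = peval (mul_op y y') (toC g * 'X - 'X) u.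
    by rewrite pevalB pevalX pevalMXr.
  apply: hs => l ls; rewrite !(hornerD, hornerN, hornerM, hornerX) toC_horner hg ?inE ?ls ?orbT //.
  by have [->|l0] := eqVneq l 0; rewrite ?mulr0 ?subr0 // mul1r subrr.
have ee u : e (e u) = e u.
  apply/eqP; rewrite -subr_eq0; apply/eqP; rewrite /e -(pevalM lb) -pevalB.
  apply: hs => l ls; rewrite !(hornerD, hornerN, hornerM) toC_horner hg ?inE ?ls ?orbT //.
  by case: (l != 0); rewrite ?mulr0 ?subr0 // mul1r subrr.
have y'e v : y' (e v) = y' v.
  apply/eqP; rewrite -subr_eq0 -(linB ly'); apply/eqP; apply: hnorm_eq0.
  by apply/eqP; rewrite -sqrf_eq0 hnorm_sqr y'y (ipBl HP) se eb subrr.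
exists e; split.
- by apply: subalg_peval => //; apply: toC_coef0.
- by [].
- by apply/funext => u; apply: hip_inj => v; rewrite /mul_op se !yy' y'e.
move=> u; have [->|e0] := eqVneq (nrm (e u)) 0; first exact: hnorm_ge0.
have ep : 0 < nrm (e u) by rewrite lt_neqAle eq_sym e0 hnorm_ge0.
by rewrite -(ler_pM2l ep) -expr2 hnorm_sqr se ee (Re_ipC HP) Re_cauchy_schwarz.
Qed.

(* With [x^2 = t^2 - (t + h)^2], the operator [x + i(t + h)] is [t] times a unitary;
   multiplying it by [x] keeps everything inside the non-unital algebra. *)
Lemma cstar_norm_le B N x (t : R) : star_subalg B -> cstar_norm B N -> B x ->
  self_adjoint x -> algebraic (mul_op x x) -> 0 <= t ->
  (forall u, nrm (x u) <= t * nrm u) -> N x <= t.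
Proof.
move=> sB [N0 [_ ND NZ _ Nst]] Bx sx alg t0 xt.
have [[bB _ BD BZ BM] _] := sB.
have lx := adj_lin sx.
have Bx2 : B (mul_op x x) by apply: BM.
have sx2 : self_adjoint (mul_op x x) by apply: adj_mul_self.
have xT u : complex.Re (hip (mul_op x x u) u) <= t ^+ 2 * nrm u ^+ 2.
  by rewrite (adj_nrm_sqr u sx) /= -exprMn ler_sqr ?nnegrE ?mulr_ge0 ?hnorm_ge0.
have [h [Bh sh hc hE]] := algebraic_sqrt_shift sB Bx2 sx2 alg (sqr_ge0 t) xT.
have hx u : x (h u) = h (x u) by apply: hc.
have lh := adj_lin sh.
rewrite sqrtr_sqr ger0_norm // in hE.
(* [k] is [x sqrt (t^2 - x^2)]; then [y1] is [x] times [x + i (t + h)], and [y2] is its adjoint. *)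
pose k := add_op (scale_op t%:C x) (mul_op h x).
have Bk : B k by apply: BD; [apply: BZ | apply: BM].
have xk u : k (x u) = x (k u).
  by rewrite /k /add_op /scale_op /mul_op (linD lx) (linZ lx) hx.
have kk u : k (k u) = (t ^+ 2)%:C *: x (x u) - x (x (x (x u))).
  have /(congr1 x) : x (x (x u)) = _ := hE (x u).
  rewrite (linN lx) (linD lx) (linZ lx) !hx => ->.
  have kE v : k v = t%:C *: x v + h (x v) by [].
  rewrite kE -xk kE.
  rewrite opprK !(linD lh) !(linZ lh) !scalerDr !scalerA -rmorphM -expr2.
  by rewrite -!addrA; congr (_ + _); rewrite addrA -scalerDl -rmorphD /= -mulr2n mulr_natl.
have sk : self_adjoint k.
  move=> u v; rewrite /k /add_op /scale_op /mul_op (ipDl HP) (ipDr HP) (ipZl HP) (ipZr HP).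
  by rewrite conjc_real sx sh sx hx.
pose y1 := add_op (mul_op x x) (scale_op 'i%C k).
pose y2 := add_op (mul_op x x) (scale_op (conjc 'i%C) k).
have By1 : B y1 by apply: BD => //; apply: BZ.
have By2 : B y2 by apply: BD => //; apply: BZ.
have y12 : adj_of y1 y2 by apply: adj_add => //; apply: adj_scale.
have i1 : 'i%C * conjc 'i%C = 1 :> C by simpc.
have i2 : conjc 'i%C * 'i%C = 1 :> C by rewrite mulrC.
have i3 : conjc 'i%C = - 'i%C :> C by simpc.
have i4 : 'i%C = - conjc 'i%C :> C by rewrite i3 opprK.
(* One computation for both products: [y1 y2] and [y2 y1] are [t^2 x^2], so [y1] and [y2] have norm
   [t * N x]. *)
have mE c d : c * d = 1 -> c = - d -> mul_op (add_op (mul_op x x) (scale_op c k))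
    (add_op (mul_op x x) (scale_op d k)) = scale_op (t ^+ 2)%:C (mul_op x x).
  move=> cd cNd; apply/funext => u; rewrite /mul_op /add_op /scale_op.
  rewrite !(linD lx) !(linZ lx) (linD (adj_lin sk)) (linZ (adj_lin sk)) scalerDr scalerA cd.
  by rewrite scale1r kk !xk cNd scaleNr addrA addrK addrC subrK.
have N1 : N y1 ^+ 2 = t ^+ 2 * N (mul_op x x).
  by rewrite -(Nst _ _ By1 By2 y12) (mE _ _ i2 i3) NZ // normc_real ger0_norm ?sqr_ge0.
have N2 : N y2 ^+ 2 = t ^+ 2 * N (mul_op x x).
  rewrite -(Nst _ _ By2 By1 (adj_sym y12)) (mE _ _ i1 i4) NZ // normc_real.
  by rewrite ger0_norm ?sqr_ge0.
have Nx2 : N (mul_op x x) = N x ^+ 2 by apply: Nst.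
have Nx := N0 _ Bx.
have NyE y : B y -> N y ^+ 2 = t ^+ 2 * N (mul_op x x) -> N y = t * N x.
  move=> By; rewrite Nx2 -exprMn => /eqP; rewrite eqrXn2 ?mulr_ge0 ?N0 //.
  by move=> /eqP.
(* The triangle inequality now reads [2 * N x ^+ 2 <= 2 * t * N x]. *)
have sum : add_op y1 y2 = scale_op 2%:C (mul_op x x).
  apply/funext => u; rewrite /y1 /y2 /add_op /scale_op addrACA -scalerDl.
  have -> : 'i%C + conjc 'i%C = 0 :> C.
    by apply/eqP; rewrite eq_complex /= addr0 subrr eqxx.
  by rewrite scale0r addr0 -mulr2n -scaler_nat rmorph_nat.
have := ND _ _ By1 By2; rewrite sum NZ // normc_real Nx2 (NyE _ By1 N1) (NyE _ By2 N2).
rewrite ger0_norm // => le2; have [->//|x0] := eqVneq (N x) 0.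
have xp : 0 < N x by rewrite lt_neqAle eq_sym x0.
by rewrite -(ler_pM2r xp) -expr2; lra.
Qed.

End Algebraic.

(** * The approximate point spectrum *)

Section ApproximateSpectrum.
Variables (R : realType) (H : hilbert R).
Local Notation C := (complex R).
Local Notation nrm := (@hnorm R H).
Local Notation toC := (map_poly (real_complex R)).
Implicit Types (a b x y : H -> H) (u v w : H) (A B : (H -> H) -> Prop).
Let HP := hilbert_semi H.

(** Comparing strictly with [e * nrm u] forces [u] to be nonzero, so no normalisation is
    required. *)
Definition approx_spectrum a (z : C) : Prop :=
  forall e : R, 0 < e -> exists u, nrm (a u - z *: u) < e * nrm u.

(** ['X - z] divides [p - p.[z]]; hence approximate eigenvectors of [a] at [z] are ones of [p(a)] at
    [p.[z]]. *)
Lemma peval_near a (p : {poly C}) (z : C) : bop a ->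
  exists2 K : R, 0 <= K & forall u, nrm (peval a p u - p.[z] *: u) <= K * nrm (a u - z *: u).
Proof.
move=> ba; have la := ba.1.
have /factor_theorem[q qE] : root (p - p.[z]%:P) z by rewrite /root !hornerE subrr.
exists (opnorm (peval a q)) => [|u]; first exact/opnorm_ge0/bop_peval.
have -> : peval a p u - p.[z] *: u = peval a q (a u - z *: u).
  by rewrite -(peval_XsubC z u la) -(pevalM la) -qE pevalB pevalC.
by apply: opnorm_bound; apply: bop_peval.
Qed.

Lemma approx_spectrum_le a (z : C) (p q : {poly C}) (d : R) : bop a -> 0 <= d ->
  approx_spectrum a z -> (forall u, d * nrm (peval a q u) <= nrm (peval a p u)) ->
  d * normc q.[z] <= normc p.[z].
Proof.
move=> ba d0 saz hpq; rewrite leNgt; apply/negP; rewrite -subr_gt0.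
set g := _ - _ => g0.
have [Kp Kp0 hp] := peval_near p z ba; have [Kq Kq0 hq] := peval_near q z ba.
(* [d * Kq + Kp] is the total error when both polynomials are replaced by their values at [z];
   adding 1 makes the final inequality strict. *)
have k0 : 0 < d * Kq + Kp + 1 by rewrite ltr_wpDl ?addr_ge0 ?mulr_ge0.
have [u hu] := saz _ (divr_gt0 g0 k0).
set e := g / _ in hu; set n := nrm u in hu; set m := nrm (a u - _) in hu.
have m0 : 0 <= m by apply: hnorm_ge0.
have e0 : 0 < e by apply: divr_gt0.
have n0 : 0 < n by rewrite -(pmulr_rgt0 _ e0); apply: le_lt_trans hu.
have p1 : nrm (peval a p u) <= normc p.[z] * n + Kp * m.
  rewrite -hnormZ -[peval a p u](subrK (p.[z] *: u)) addrC.
  by apply: le_trans (hnorm_triangle _ _) _; rewrite lerD2l.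
have q1 : normc q.[z] * n - Kq * m <= nrm (peval a q u).
  rewrite lerBlDr -hnormZ -[q.[z] *: u](subrK (peval a q u)) addrC.
  apply: le_trans (hnorm_triangle _ _) _; rewrite lerD2l.
  by rewrite -hnormN opprB.
have h1 := le_trans (ler_wpM2l d0 q1) (le_trans (hpq u) p1).
have h2 : g * n <= (d * Kq + Kp) * m by move: h1; rewrite /g; lra.
have h3 : (d * Kq + Kp) * m <= (d * Kq + Kp) * (e * n).
  by rewrite ler_wpM2l ?addr_ge0 ?mulr_ge0 // ltW.
have h4 : (d * Kq + Kp) * (e * n) < g * n.
  have -> : g = (d * Kq + Kp + 1) * e by rewrite mulrC divfK // gt_eqF.
  rewrite mulrA ltr_pM2r // ltr_pM2r //; lra.
by have := le_lt_trans (le_trans h2 h3) h4; rewrite ltxx.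
Qed.

Lemma approx_spectrum_real a (z : C) : self_adjoint a -> approx_spectrum a z ->
  z = (complex.Re z)%:C.
Proof.
move=> sa saz; suff : complex.Im z = 0 by case: z saz => p q _ /= ->.
apply/eqP; apply: contraT => Iz0.
have Ip : 0 < `|complex.Im z| by rewrite normr_gt0.
have [u hu] := saz _ Ip.
have n0 : 0 < nrm u.
  by rewrite -(pmulr_rgt0 _ Ip); apply: le_lt_trans (hnorm_ge0 _) hu.
suff : `|complex.Im z| * nrm u * nrm u <= nrm (a u - z *: u) * nrm u.
  by rewrite ler_pM2r // leNgt hu.
apply: le_trans _ (cauchy_schwarz HP _ _); apply: le_trans _ (normc_Im _).
rewrite (ipBl HP) (ipZl HP) ImD ImN self_adjoint_Im // sub0r normrN (ip_nrm HP).
by rewrite [z * _]mulrC ImMr normrM ger0_norm ?sqr_ge0 // -mulrA -expr2 mulrC.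
Qed.

(** A product of operators bounded below is bounded below, so some factor is not. *)
Lemma approx_spectrum_factor a (r : seq C) : bop a ->
  (forall e : R, 0 < e ->
     exists u, nrm (peval a (\prod_(z <- r) ('X - z%:P)) u) < e * nrm u) ->
  exists2 z, z \in r & approx_spectrum a z.
Proof.
move=> ba; have la := ba.1; elim: r => [|z r IH] hr.
  by have [u] := hr 1 ltr01; rewrite big_nil peval1 mul1r ltxx.
have [|nsaz] := pselect (approx_spectrum a z); first by exists z; rewrite // inE eqxx.
have [c c0 hc] : exists2 c : R, 0 < c & forall u, c * nrm u <= nrm (a u - z *: u).
  apply: contrapT => nc; apply: nsaz => e e0; apply: contrapT => ne; apply: nc.
  by exists e => // u; rewrite leNgt; apply/negP => hu; apply: ne; exists u.
have [|z' z'r ?] := IH; last by exists z'; rewrite // inE z'r orbT.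
move=> e e0; have [u] := hr (c * e) (mulr_gt0 c0 e0).
rewrite big_cons (pevalM la) (peval_XsubC _ _ la) -mulrA => hu; exists u.
by rewrite -(ltr_pM2l c0); apply: le_lt_trans (hc _) hu.
Qed.

(* For [M = opnorm b], [|b^2 u - M^2 u|^2 <= M^2 (M^2 |u|^2 - |b u|^2)]. *)
Lemma self_adjoint_approx_norm b : bop b -> self_adjoint b -> 0 < opnorm b ->
  forall e : R, 0 < e -> exists u,
    nrm (b (b u) - (opnorm b ^+ 2)%:C *: u) < e * nrm u.
Proof.
move=> bb sb; set M := opnorm b => M0 e e0; apply: contrapT => ne.
have he u : e * nrm u <= nrm (b (b u) - (M ^+ 2)%:C *: u).
  by rewrite leNgt; apply/negP => hu; apply: ne; exists u.
(* A lower bound [e] would improve the estimate to |b u|^2 <= s |u|^2 with [s < M ^+ 2], against the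
   choice of [M]. The maximum with 0 ensures that [s] has a square root. *)
pose s := Num.max 0 (M ^+ 2 - e ^+ 2 / M ^+ 2).
have s0 : 0 <= s by rewrite le_max lexx.
have M2 : 0 < M ^+ 2 by rewrite exprn_gt0.
have sM : s < M ^+ 2 by rewrite gt_max M2 /= gtrBl divr_gt0 // exprn_gt0.
suff : M <= Num.sqrt s.
  move=> h; suff : M ^+ 2 <= s by rewrite leNgt sM.
  by rewrite -[s]sqr_sqrtr // ler_sqr ?nnegrE ?sqrtr_ge0 // ltW.
apply: opnorm_le; rewrite ?sqrtr_ge0 // => u.
rewrite -ler_sqr ?nnegrE ?mulr_ge0 ?sqrtr_ge0 ?hnorm_ge0 // exprMn.
have -> : Num.sqrt s ^+ 2 = s by rewrite sqr_sqrtr.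
have h1 : (e * nrm u) ^+ 2 <= nrm (b (b u) - (M ^+ 2)%:C *: u) ^+ 2.
  by rewrite ler_sqr ?nnegrE ?mulr_ge0 ?hnorm_ge0 ?(ltW e0).
have h2 : nrm (b (b u)) ^+ 2 <= (M * nrm (b u)) ^+ 2.
  by rewrite ler_sqr ?nnegrE ?mulr_ge0 ?hnorm_ge0 ?(ltW M0) // opnorm_bound.
have h3 : nrm (b (b u) - (M ^+ 2)%:C *: u) ^+ 2 =
   nrm (b (b u)) ^+ 2 - 2 * M ^+ 2 * nrm (b u) ^+ 2 + M ^+ 4 * nrm u ^+ 2.
  rewrite /hnorm (nrm_sqrD HP) -!/(hnorm _) (ipNr HP) (ipZr HP) sb (ip_nrm HP).
  rewrite conjc_real ReN ReMr /= hnormN hnormZ normc_real exprMn real_normK ?num_real //.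
  by rewrite -/(hnorm (b u)); ring.
have h4 : M ^+ 2 * nrm (b u) ^+ 2 <= (M ^+ 4 - e ^+ 2) * nrm u ^+ 2.
  by move: h1 h2; rewrite h3 !exprMn; lra.
apply: le_trans (_ : (M ^+ 2 - e ^+ 2 / M ^+ 2) * nrm u ^+ 2 <= _); last first.
  by rewrite ler_wpM2r ?sqr_ge0 // le_max lexx orbT.
rewrite -(ler_pM2l M2); apply: le_trans h4 _.
rewrite [leRHS]mulrA; have -> : M ^+ 2 * (M ^+ 2 - e ^+ 2 / M ^+ 2) = M ^+ 4 - e ^+ 2.
  by field; rewrite gt_eqF.
by [].
Qed.

(** Stands in for the spectral radius formula: with [M] the norm of [q(a)], the operator
    [q(a)^2 - M^2] is not bounded below, so neither is one of its linear factors in [a]. A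
    nonconstant [q] keeps the polynomial [P] nonzero. *)
Lemma approx_spectrum_norm a (q : {poly R}) : bop a -> self_adjoint a ->
  (1 < size q)%N -> 0 < opnorm (peval a (toC q)) ->
  exists2 z, approx_spectrum a z & (toC q).[z] ^+ 2 = (opnorm (peval a (toC q)) ^+ 2)%:C.
Proof.
move=> ba sa q1; set b := peval a (toC q) => b0; have la := ba.1.
have bb : bop b by apply: bop_peval.
have sb : self_adjoint b by apply: self_adjoint_peval.
pose P := toC q * toC q - (opnorm b ^+ 2)%:C%:P.
have q0 : toC q != 0 by rewrite map_poly_eq0 -size_poly_gt0 ltnW.
have P0 : P != 0.
  apply/negP; rewrite subr_eq0 => /eqP/(congr1 (fun p : {poly C} => size p)).
  rewrite size_mul // size_map_poly => h.
  have := size_polyC_leq1 (opnorm b ^+ 2)%:C; rewrite -h.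
  by case: (size q) q1 => [|[|n]] // _; rewrite addSn addnS.
have [r rE] := closed_field_poly_normal P.
have lP : lead_coef P != 0 by rewrite lead_coef_eq0.
have nlP : 0 < normc (lead_coef P).
  rewrite lt_neqAle normc_ge0 andbT eq_sym; apply: contra lP => /eqP.
  by move=> /ComplexField.Normc.eq0_normc ->.
have [|z zr az] := @approx_spectrum_factor a r ba.
  move=> e e0; have [u hu] := self_adjoint_approx_norm bb sb b0 (mulr_gt0 nlP e0).
  exists u; rewrite -(ltr_pM2l nlP) mulrA -hnormZ -pevalZ -rE; apply: le_lt_trans hu.
  by rewrite /P pevalB pevalC (pevalM la).
exists z => //; apply/eqP; rewrite -subr_eq0.
have : root P z by rewrite rE rootZ // root_prod_XsubC.
by rewrite /root /P hornerD hornerN hornerM hornerC expr2.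
Qed.

Lemma finite_approx_spectrum_algebraic a (s : seq R) : bop a -> self_adjoint a ->
  (forall l : R, approx_spectrum a l%:C -> l \in s) -> algebraic a.
Proof.
move=> ba sa hs.
(* The node 0 keeps [q] nonconstant even for empty [s]. *)
pose q := \prod_(l <- 0 :: s) ('X - l%:P) : {poly R}.
have q1 : (1 < size q)%N by rewrite size_prod_XsubC.
have q0 : toC q != 0 by rewrite map_poly_eq0 -size_poly_gt0 ltnW.
have bb : bop (peval a (toC q)) by apply: bop_peval.
have [M0|M0] := eqVneq (opnorm (peval a (toC q))) 0.
  exists (toC q) => // u; apply: hnorm_eq0; apply/eqP; rewrite eq_le hnorm_ge0 andbT.
  by rewrite -(mul0r (nrm u)) -M0 opnorm_bound.
have Mp : 0 < opnorm (peval a (toC q)) by rewrite lt_neqAle eq_sym M0 opnorm_ge0.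
have [z az] := approx_spectrum_norm ba sa q1 Mp.
have zE := approx_spectrum_real sa az.
have ls : complex.Re z \in s by apply: hs; rewrite -zE.
rewrite zE toC_horner; have -> : q.[complex.Re z] = 0.
  by apply/eqP; rewrite -/(root _ _) root_prod_XsubC inE ls orbT.
by rewrite expr0n /= => -[/esym/eqP]; rewrite sqrf_eq0 (negPf M0).
Qed.

Lemma approx_spectrum_in a (z : C) : approx_spectrum a z -> in_spectrum a z.
Proof.
move=> saz [S [bS SK _]].
have k0 : 0 < opnorm S + 1 by rewrite ltr_wpDl ?opnorm_ge0.
have ip : 0 < (opnorm S + 1)^-1 by rewrite invr_gt0.
have [u hu] := saz _ ip.
have := opnorm_bound (a u - z *: u) bS; rewrite SK leNgt => /negP; apply.
have n0 : 0 < nrm u.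
  by rewrite -(pmulr_rgt0 _ ip); apply: le_lt_trans (hnorm_ge0 _) hu.
move: hu; rewrite mulrC ltr_pdivlMr // mulrC => hu; apply: le_lt_trans hu.
by rewrite ler_wpM2r ?hnorm_ge0 // lerDl.
Qed.

Lemma finite_spectrum_algebraic a : bop a -> self_adjoint a -> finite_spectrum a ->
  algebraic a.
Proof.
move=> ba sa [s hs]; apply: (@finite_approx_spectrum_algebraic _ [seq complex.Re z | z <- s]) => //.
by move=> l /approx_spectrum_in/hs/(map_f (@complex.Re R)).
Qed.

(** If [p.[l]] is nonzero, the quotient of [p - p.[l]] by ['X - l] yields an inverse of [a - l],
    because [p(a) = 0]. *)
Lemma algebraic_finite_spectrum a : bop a -> algebraic a -> finite_spectrum a.
Proof.
move=> ba [p p0 pa]; have la := ba.1.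
have [r rE] := closed_field_poly_normal p.
exists r => l sl; rewrite -root_prod_XsubC -(rootZ _ _ (_ : lead_coef p != 0)) ?lead_coef_eq0 //.
rewrite -rE; apply: contraT => pl; case: sl.
have /factor_theorem[q qE] : root (p - p.[l]%:P) l by rewrite /root !hornerE subrr.
have hq u : peval a (q * ('X - l%:P)) u = - p.[l] *: u.
  by rewrite -qE pevalB pevalC pa sub0r scaleNr.
exists (scale_op (- p.[l])^-1 (peval a q)); split.
- exact/bop_scale/bop_peval.
- move=> u; rewrite /scale_op -(peval_XsubC l u la) -(pevalM la) hq scalerA mulVf ?scale1r //.
  by rewrite oppr_eq0.
- move=> u; rewrite -(peval_XsubC _ _ la) /scale_op -pevalZ -(pevalM la) mulrC -scalerAl.
  rewrite pevalZ hq scalerA mulVf ?scale1r //.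
  by rewrite oppr_eq0.
Qed.

(** From [c y c = c] follows |c u|^2 = <y c u, c c u>, so [c] is bounded below on its range. At an
    approximate eigenvalue [l], the number [q.[l] = l (l - m)] is thus 0 or at least [d] in modulus,
    and the latter is impossible near [m]. *)
Lemma regular_approx_spectrum_isolated A a (m : R) : star_subalg A -> A a ->
  self_adjoint a -> (forall x, A x -> exists2 y, A y & mul_op (mul_op x y) x = x) ->
  exists2 e : R, 0 < e & forall l : R, approx_spectrum a l%:C -> `|l - m| < e ->
    l \in [:: m; 0].
Proof.
move=> [sA _] Aa sa hreg; have ba : bop a by case: sA => + _ _ _ _; apply.
have la := ba.1.
(* The factor ['X] places [c] in [A]; it is the source of the exceptional point 0. *)
pose q : {poly R} := 'X * ('X - m%:P).
pose c := peval a (toC q).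
have q00 : (toC q)`_0 = 0 by apply: toC_coef0; rewrite hornerM hornerX mul0r.
have Ac : A c by apply: subalg_peval.
have sc : self_adjoint c by apply: self_adjoint_peval.
have [y Ay cyc] := hreg c Ac.
have by_ : bop y by case: sA => + _ _ _ _; apply.
have yn := opnorm_ge0 by_.
have y0 : 0 < opnorm y + 1 by rewrite ltr_wpDl.
pose d := (opnorm y + 1)^-1; have d0 : 0 < d by rewrite invr_gt0.
have gap u : d * nrm (peval a (toC q) u) <= nrm (peval a (toC q * toC q) u).
  rewrite (pevalM la) -/(c u) -/(c (c u)) mulrC ler_pdivrMr //.
  have [->|c0] := eqVneq (nrm (c u)) 0; first by rewrite mulr_ge0 ?hnorm_ge0 // ltW.
  have cp : 0 < nrm (c u) by rewrite lt_neqAle eq_sym c0 hnorm_ge0.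
  rewrite -(ler_pM2r cp) -expr2 hnorm_sqr.
  have {1}-> : c u = c (y (c u)) by rewrite -{1}cyc.
  rewrite sc; apply: le_trans (Re_cauchy_schwarz HP _ _) _.
  rewrite mulrC -mulrA ler_wpM2l ?hnorm_ge0 //.
  apply: le_trans (opnorm_bound _ by_) _.
  by rewrite ler_wpM2r ?hnorm_ge0 // lerDl.
have an := opnorm_ge0 ba.
have a0 : 0 < opnorm a + 1 by rewrite ltr_wpDl.
(* Since |l| is at most [opnorm a], this radius makes [|l| * |l - m|] smaller than [d]. *)
exists (d / (opnorm a + 1)); first exact: divr_gt0.
move=> l sl lm.
have la1 : `|l| <= opnorm a.
  have := @approx_spectrum_le a l%:C (opnorm a)%:C%:P 'X 1 ba ler01 sl.
  rewrite hornerX hornerC !normc_real mul1r (ger0_norm an); apply=> u.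
  by rewrite pevalX pevalC mul1r hnormZ normc_real ger0_norm // opnorm_bound.
have := approx_spectrum_le ba (ltW d0) sl gap.
rewrite hornerM ComplexField.Normc.normcM toC_horner !normc_real.
have [ql|ql] := eqVneq q.[l] 0.
  move=> _; move/eqP: ql; rewrite hornerM hornerXsubC hornerX mulf_eq0 subr_eq0 !inE.
  by rewrite orbC.
rewrite ler_pM2r ?normr_gt0 // hornerM hornerXsubC hornerX normrM.
move=> h; suff : `|l| * `|l - m| < d by rewrite ltNge h.
move: lm; rewrite ltr_pdivlMr // mulrC; apply: le_lt_trans.
by rewrite ler_wpM2r // (le_trans la1) // lerDl.
Qed.

Lemma discrete_bounded_finite (P : R -> Prop) (M l0 : R) : (forall l, P l -> `|l| <= M) ->
  (forall m, exists2 e : R, 0 < e & forall l, P l -> `|l - m| < e -> l \in [:: m; l0]) ->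
  exists s : seq R, forall l, P l -> l \in s.
Proof.
move=> PM Pd.
(* As in the proof of Heine-Borel, the bound [sup S] can be overstepped. *)
pose S := [set r : R | r <= M + 1 /\
  exists s : seq R, forall l, P l -> l <= r -> l \in s]%classic.
have [M0|M0] := ltP M 0.
  by exists [::] => l /PM/(le_trans (normr_ge0 _)); rewrite leNgt M0.
have Sb : has_ubound S by exists (M + 1) => r [].
have Sn : (S !=set0)%classic.
  exists (- M - 1); split; first by lra.
  by exists [::] => l /PM; rewrite ler_norml => /andP[]; lra.
have [e e0 he] := Pd (sup S).
have [r [rM [s hs]] re] := sup_adherent e0 (conj Sn Sb).
have cov l : P l -> l <= sup S + e / 2 -> l \in s ++ [:: sup S; l0].
  move=> Pl lS; rewrite mem_cat; have [lr|rl] := leP l r; first by rewrite hs.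
  by rewrite (he l) ?orbT // ltr_norml; apply/andP; split; lra.
have [h|h] := leP (sup S + e / 2) (M + 1).
  have : sup S + e / 2 <= sup S by apply: ub_le_sup => //; split=> //; eexists; exact: cov.
  by lra.
exists (s ++ [:: sup S; l0]) => l Pl; apply: cov => //.
by have := le_trans (ler_norm l) (PM l Pl); lra.
Qed.

Lemma regular_algebraic A a : star_subalg A -> A a -> self_adjoint a ->
  (forall x, A x -> exists2 y, A y & mul_op (mul_op x y) x = x) -> algebraic a.
Proof.
move=> sA Aa sa hreg; have ba : bop a by case: sA => -[+ _ _ _ _] _; apply.
have an := opnorm_ge0 ba.
have [|m|s hs] := @discrete_bounded_finite (fun l => approx_spectrum a l%:C) (opnorm a) 0.
- move=> l sl; have := @approx_spectrum_le a l%:C (opnorm a)%:C%:P 'X 1 ba ler01 sl.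
  rewrite hornerX hornerC !normc_real mul1r (ger0_norm an); apply=> u.
  by rewrite pevalX pevalC mul1r hnormZ normc_real ger0_norm // opnorm_bound.
- exact: regular_approx_spectrum_isolated hreg.
exact: finite_approx_spectrum_algebraic hs.
Qed.

End ApproximateSpectrum.

(** * Uniqueness and non-uniqueness of C*-norms *)

Section UniqueNorm.
Variables (R : realType) (H : hilbert R).
Local Notation C := (complex R).
Local Notation nrm := (@hnorm R H).
Local Notation toC := (map_poly (real_complex R)).
Implicit Types (a x y : H -> H) (u v w : H) (A B : (H -> H) -> Prop).
Let HP := hilbert_semi H.

Lemma peval_eigen a (z : C) (p : {poly C}) u : lin_op a -> a u = z *: u ->
  peval a p u = p.[z] *: u.
Proof.
move=> la au; elim/poly_ind: p => [|p c IH]; first by rewrite peval0 horner0 scale0r.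
by rewrite pevalD pevalC (pevalMXr a) au (linZ (fun c => peval_lin la p c)) IH
  hornerD hornerMX hornerC scalerDl scalerA mulrC.
Qed.

(** If [e] is the spectral projection at an eigenvalue [l], then [x e = l e] gives |l| <= N x. So
    [N x ^+ 2 - x^2] is the square of a self-adjoint polynomial in [x], hence positive. *)
Lemma cstar_norm_ge B N x : star_subalg B -> cstar_norm B N -> B x ->
  self_adjoint x -> algebraic x -> forall u, nrm (x u) <= N x * nrm u.
Proof.
move=> sB [N0 [N00 _ NZ NM _]] Bx sx ax.
have [sBB _] := sB; have lx := adj_lin sx.
have [s es hs] := algebraic_spectrum sx ax.
have sN l : l \in s -> `|l| <= N x.
  move=> ls; have [->|l0] := eqVneq l 0; first by rewrite normr0 N0.
  (* As [l] is nonzero, its indicator vanishes at 0 and the projection lies in [B]. *)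
  have [g hg] := interpolation (0 :: s) (fun m => (m == l)%:R).
  have g0 : g.[0] = 0 by rewrite hg ?inE ?eqxx // eq_sym (negPf l0).
  pose e := peval x (toC g).
  have Be : B e by apply: subalg_peval => //; apply: toC_coef0.
  have [u u0 xu] := es l ls.
  have e0 : N e != 0.
    apply/eqP => /(N00 _ Be)/(congr1 (fun f : H -> H => f u)); rewrite /zero_op /e.
    by rewrite (peval_eigen _ lx xu) toC_horner hg ?inE ?ls ?orbT // eqxx scale1r.
  have xe : mul_op x e = scale_op l%:C e.
    apply/funext => v; rewrite /mul_op /scale_op -(pevalX x (e v)) -(pevalM lx) -pevalZ.
    apply/eqP; rewrite -subr_eq0 -pevalB; apply/eqP; apply: hs => m ms.
    rewrite hornerD hornerN hornerZ hornerM hornerX toC_horner hg ?inE ?ms ?orbT //.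
    by have [->|_] := eqVneq m l; rewrite ?subrr // !mulr0 subrr.
  have := NM x e Bx Be; rewrite xe NZ // normc_real ler_pM2r //.
  by rewrite lt_neqAle eq_sym e0 N0.
have t0 := N0 _ Bx; set t := N x in sN t0 *.
(* No node 0 here: this square root is only applied to vectors and may leave [B]. *)
have [g hg] := interpolation s (fun l => Num.sqrt (t ^+ 2 - l ^+ 2)).
have sg : self_adjoint (peval x (toC g)) by apply: self_adjoint_peval.
move=> u; rewrite -ler_sqr ?nnegrE ?mulr_ge0 ?hnorm_ge0 // exprMn.
suff -> : nrm (x u) ^+ 2 = t ^+ 2 * nrm u ^+ 2 - nrm (peval x (toC g) u) ^+ 2.
  by rewrite gerBl sqr_ge0.
rewrite !hnorm_sqr sx sg -(pevalM lx) (Re_ipC HP) [X in _ - X](Re_ipC HP) -ReMr -(ipZl HP).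
rewrite -ReN -ReD -(ipNl HP) -(ipDl HP); congr (complex.Re (hip _ _)).
have -> : x (x u) = peval x ('X * 'X) u by rewrite pevalMXr pevalX.
rewrite -[_ *: u](pevalC x) -pevalB; apply/eqP; rewrite -subr_eq0 -pevalB; apply/eqP.
apply: hs => l ls; rewrite !(hornerD, hornerN, hornerM, hornerX, hornerC) toC_horner hg //.
have h : Num.sqrt (t ^+ 2 - l ^+ 2) * Num.sqrt (t ^+ 2 - l ^+ 2) = t ^+ 2 - l ^+ 2.
  rewrite -expr2 sqr_sqrtr // subr_ge0 -[l ^+ 2]real_normK ?num_real //.
  by rewrite ler_sqr ?nnegrE // sN.
rewrite -!rmorphM h -!rmorphB /=.
by have -> : l * l - (t ^+ 2 - (t ^+ 2 - l ^+ 2)) = 0 by ring.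
Qed.

(** The two bounds determine [N] on self-adjoint elements; the C*-identity carries this over to all
    of [B]. *)
Lemma algebraic_unique_cstar_norm B : star_subalg B ->
  (forall a, B a -> self_adjoint a -> algebraic a) -> unique_cstar_norm B.
Proof.
move=> sB alg; split; first by exists (@opnorm R H); apply: opnorm_cstar.
have [[bB _ _ _ BM] Bs] := sB.
suff key N x : cstar_norm B N -> B x -> N x = opnorm x.
  by move=> N1 N2 h1 h2 x Bx; rewrite !key.
move=> cN Bx.
have sa y : B y -> self_adjoint y -> N y = opnorm y.
  move=> By sy; have by_ := bB _ By; apply/eqP; rewrite eq_le; apply/andP; split.
    have ay : algebraic (mul_op y y) by apply: alg; [apply: BM | apply: adj_mul_self].
    by apply: (cstar_norm_le sB cN By sy ay (opnorm_ge0 by_)) => u; apply: opnorm_bound.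
  apply: opnorm_le; first by case: cN => + _; apply.
  exact: (cstar_norm_ge sB cN By sy (alg _ By sy)).
have [y By xy] := Bs x Bx.
have Byx : B (mul_op y x) by apply: BM.
have [_ [_ _ _ _ +]] := opnorm_cstar sB => /(_ x y Bx By xy) oE.
have [_ [_ _ _ _ +]] := cN => /(_ x y Bx By xy) NE.
have : N x ^+ 2 = opnorm x ^+ 2 by rewrite -oE -NE sa //; apply: adj_mul_self.
move/eqP; rewrite eqrXn2 ?opnorm_ge0 //; [by move/eqP | by case: cN => + _; apply | exact: bB].
Qed.

End UniqueNorm.

(** * Sup norms of polynomials on [0, T] *)

Section SupNorm.
Variables (R : realType) (T : R).
Local Notation C := (complex R).
Hypothesis T0 : 0 < T.
Implicit Types p q : {poly C}.

Definition supnorm p : R :=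
  sup [set r | exists2 t : R, 0 <= t <= T & r = normc p.[t%:C]]%classic.

Lemma horner_bounded p : exists K : R, forall t : R, 0 <= t <= T -> normc p.[t%:C] <= K.
Proof.
elim/poly_ind: p => [|p c [K hK]].
  by exists 0 => t _; rewrite horner0 ComplexField.Normc.normc0.
exists (K * T + normc c) => t ht; rewrite hornerD hornerMX hornerC.
apply: le_trans (le_normcD _ _) _; rewrite lerD2r ComplexField.Normc.normcM.
case/andP: (ht) => t0 tT; rewrite normc_real ger0_norm //.
by apply: ler_pM; rewrite ?normc_ge0 // hK.
Qed.

Lemma supnorm_ub p t : 0 <= t <= T -> normc p.[t%:C] <= supnorm p.
Proof.
move=> ht; apply: ub_le_sup; last by exists t.
by have [K hK] := horner_bounded p; exists K => _ [s hs ->]; apply: hK.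
Qed.

Lemma supnorm_le p M : (forall t, 0 <= t <= T -> normc p.[t%:C] <= M) -> supnorm p <= M.
Proof.
move=> h; apply: ge_sup; last by move=> _ [s hs ->]; apply: h.
by exists (normc p.[0%:C]); exists 0; rewrite // lexx ltW.
Qed.

Lemma supnorm_ge0 p : 0 <= supnorm p.
Proof. by apply: le_trans (normc_ge0 _) (supnorm_ub p (_ : 0 <= 0 <= T)); rewrite lexx ltW. Qed.

Lemma supnorm_eq0 p : supnorm p = 0 -> p = 0.
Proof.
move=> h; apply/eqP; apply: contraT => p0.
have pt t : 0 <= t <= T -> root p t%:C.
  move=> ht; apply/eqP/ComplexField.Normc.eq0_normc/eqP.
  by rewrite eq_le normc_ge0 andbT -h supnorm_ub.
(* As many distinct roots as coefficients: one too many for a nonzero [p]. *)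
pose rs := [seq (T / i.+1%:R)%:C | i <- iota 0 (size p)].
have : (size rs < size p)%N.
  apply: max_poly_roots => //.
    apply/allP => _ /mapP[i _ ->]; apply: pt.
    by rewrite divr_ge0 ?(ltW T0) //= ler_pdivrMr // ler_peMr ?(ltW T0) // ler1n.
  rewrite map_inj_uniq ?iota_uniq // => i j /complexI/(mulfI (lt0r_neq0 T0))/invr_inj/eqP.
  by rewrite eqr_nat => /eqP[].
by rewrite size_map size_iota ltnn.
Qed.

Lemma supnormD p q : supnorm (p + q) <= supnorm p + supnorm q.
Proof.
apply: supnorm_le => t ht; rewrite hornerD; apply: le_trans (le_normcD _ _) _.
by rewrite lerD // supnorm_ub.
Qed.

Lemma supnormM p q : supnorm (p * q) <= supnorm p * supnorm q.
Proof.
apply: supnorm_le => t ht; rewrite hornerM ComplexField.Normc.normcM.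
by apply: ler_pM; rewrite ?normc_ge0 ?supnorm_ub.
Qed.

Lemma supnormZ c p : supnorm (c *: p) = normc c * supnorm p.
Proof.
have le d q : supnorm (d *: q) <= normc d * supnorm q.
  apply: supnorm_le => t ht; rewrite hornerZ ComplexField.Normc.normcM.
  by rewrite ler_wpM2l ?normc_ge0 ?supnorm_ub.
apply/eqP; rewrite eq_le le /=; have [->|c0] := eqVneq c 0.
  by rewrite ComplexField.Normc.normc0 mul0r supnorm_ge0.
have nc : 0 < normc c.
  rewrite lt_neqAle normc_ge0 andbT eq_sym; apply: contra c0 => /eqP.
  by move=> /ComplexField.Normc.eq0_normc ->.
rewrite mulrC -ler_pdivlMr // mulrC -ComplexField.Normc.normcV.
by rewrite -{1}[p]scale1r -(mulVf c0) -scalerA le.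
Qed.

Lemma supnorm_star p : supnorm (map_poly conjc p * p) = supnorm p ^+ 2.
Proof.
have E t : normc (map_poly conjc p * p).[t%:C] = normc p.[t%:C] ^+ 2.
  rewrite hornerM -{1}(conjc_real t) horner_map /= ComplexField.Normc.normcM.
  by rewrite normc_conj.
apply/eqP; rewrite eq_le; apply/andP; split.
  apply: supnorm_le => t ht.
  by rewrite E ler_sqr ?nnegrE ?normc_ge0 ?supnorm_ge0 // supnorm_ub.
rewrite -[leRHS]sqr_sqrtr ?supnorm_ge0 // ler_sqr ?nnegrE ?sqrtr_ge0 ?supnorm_ge0 //.
apply: supnorm_le => t ht; rewrite -ler_sqr ?nnegrE ?normc_ge0 ?sqrtr_ge0 //.
by rewrite sqr_sqrtr ?supnorm_ge0 // -E supnorm_ub.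
Qed.

Lemma supnormX : supnorm 'X = T.
Proof.
apply/eqP; rewrite eq_le; apply/andP; split.
  by apply: supnorm_le => t /andP[t0 tT]; rewrite hornerX normc_real ger0_norm.
have TT : 0 <= T <= T by rewrite ltW /=.
by have := supnorm_ub 'X TT; rewrite hornerX normc_real ger0_norm // ltW.
Qed.

End SupNorm.

(** * The algebra generated by a non-algebraic operator *)

Section Transcendental.
Variables (R : realType) (H : hilbert R) (c : H -> H).
Local Notation C := (complex R).
Hypotheses (bc : bop c) (sc : self_adjoint c) (nc : ~ algebraic c).

(** Inverse of evaluation at [c] on [gen_subalg c], single-valued because [c] is not algebraic;
    outside it the default 0 is returned. *)
Definition poly_of (x : H -> H) : {poly C} :=
  xget 0 [set p : {poly C} | p`_0 = 0 /\ x = peval c p]%classic.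

Lemma peval_inj (p q : {poly C}) : peval c p = peval c q -> p = q.
Proof.
move=> pq; apply/eqP; rewrite -subr_eq0; apply: contraT => h; exfalso; apply: nc.
by exists (p - q) => // u; rewrite pevalB pq subrr.
Qed.

Lemma poly_ofE (p : {poly C}) : p`_0 = 0 -> poly_of (peval c p) = p.
Proof.
move=> p0; rewrite /poly_of; case: xgetP => [q _ [_ /peval_inj->//]|/(_ p)].
by case; split.
Qed.

Lemma poly_of_gen x : gen_subalg c x -> (poly_of x)`_0 = 0 /\ x = peval c (poly_of x).
Proof. by move=> /(gen_subalgP _ bc)[p p0 ->]; rewrite poly_ofE. Qed.

Lemma poly_of_add x y : gen_subalg c x -> gen_subalg c y ->
  poly_of (add_op x y) = poly_of x + poly_of y.
Proof.
move=> /poly_of_gen[x0 xE] /poly_of_gen[y0 yE]; rewrite -[RHS]poly_ofE.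
  by congr poly_of; rewrite {1}xE {1}yE; apply/funext => u; rewrite pevalD.
by rewrite coefD x0 y0 addr0.
Qed.

Lemma poly_of_scale d x : gen_subalg c x -> poly_of (scale_op d x) = d *: poly_of x.
Proof.
move=> /poly_of_gen[x0 xE]; rewrite -[RHS]poly_ofE ?coefZ ?x0 ?mulr0 //.
by congr poly_of; rewrite {1}xE; apply/funext => u; rewrite pevalZ.
Qed.

Lemma poly_of_mul x y : gen_subalg c x -> gen_subalg c y ->
  poly_of (mul_op x y) = poly_of x * poly_of y.
Proof.
move=> /poly_of_gen[x0 xE] /poly_of_gen[y0 yE]; rewrite -[RHS]poly_ofE.
  by congr poly_of; rewrite {1}xE {1}yE; apply/funext => u; rewrite (pevalM bc.1).
by rewrite coef0M x0 mul0r.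
Qed.

Lemma poly_of_adj x y : gen_subalg c x -> adj_of x y ->
  poly_of y = map_poly conjc (poly_of x).
Proof.
move=> /poly_of_gen[x0 xE] xy; have := adj_peval (poly_of x) sc; rewrite -xE => xy'.
by rewrite (adj_unique xy xy') poly_ofE // coef_map x0; apply: conjc0.
Qed.

Lemma gen_self : gen_subalg c c. Proof. by move=> S. Qed.

Lemma poly_of_self : poly_of c = 'X.
Proof.
rewrite -[RHS]poly_ofE ?coefX //; congr poly_of.
by apply/funext => u; rewrite pevalX.
Qed.

Lemma supnorm_cstar (T : R) : 0 < T -> cstar_norm (gen_subalg c) (fun x => supnorm T (poly_of x)).
Proof.
move=> T0; split; first by move=> x _; apply: supnorm_ge0.
split.
- move=> x /poly_of_gen[_ xE] /(supnorm_eq0 T0) p0; rewrite xE p0.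
  by apply/funext => u; rewrite peval0.
- by move=> x y gx gy; rewrite poly_of_add // supnormD.
- by move=> d x gx; rewrite poly_of_scale // supnormZ.
- by move=> x y gx gy; rewrite poly_of_mul // supnormM.
- by move=> x y gx gy xy; rewrite poly_of_mul // (poly_of_adj gx xy) supnorm_star.
Qed.

Lemma transcendental_not_unique : ~ unique_cstar_norm (gen_subalg c).
Proof.
move=> [_ /(_ _ _ (supnorm_cstar ltr01) (supnorm_cstar (ltr0n R 2)))].
move=> /(_ _ gen_self); rewrite poly_of_self !supnormX ?ltr01 ?ltr0n //; lra.
Qed.

End Transcendental.

Lemma algebraic_sqr (R : realType) (H : hilbert R) (a : H -> H) : bop a ->
  algebraic (mul_op a a) -> algebraic a.
Proof.
move=> [la _] [p p0 pa]; exists (p \Po 'X^2); last first.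
  by move=> u; rewrite peval_comp_sqr //; apply: pa.
by rewrite comp_poly_eq0 // size_polyXn.
Qed.

(** * The extension property forces algebraicity *)

Section Completeness.
Variable R : realType.
Local Notation C := (complex R).

Lemma real_cauchy_converges (s : nat -> R) :
  (forall e, 0 < e -> exists N, forall m n, (N <= m)%N -> (N <= n)%N -> `|s m - s n| < e) ->
  exists l, forall e, 0 < e -> exists N, forall n, (N <= n)%N -> `|s n - l| < e.
Proof.
(* The supremum of [E], the eventual lower bounds, is the lower limit of the sequence. *)
move=> cs; pose E := [set r | exists N, forall n, (N <= n)%N -> r <= s n]%classic.
have near e : 0 < e -> exists N, E (s N - e) /\ ubound E (s N + e) /\
    forall n, (N <= n)%N -> `|s n - s N| < e.
  move=> e0; have [N hN] := cs e e0; exists N.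
  have h n : (N <= n)%N -> `|s n - s N| < e by move=> Nn; apply: hN.
  split; [|split=> //].
    by exists N => n /h; rewrite ltr_norml => /andP[]; lra.
  move=> r [M hM]; have := hM _ (leq_maxl M N); have := h _ (leq_maxr M N).
  by rewrite ltr_norml => /andP[]; lra.
exists (sup E) => e e0; have e2 : 0 < e / 2 by lra.
have [N [EN [uN hN]]] := near _ e2; exists N => n /hN.
have h1 : s N - e / 2 <= sup E by apply: ub_le_sup => //; exists (s N + e / 2).
have h2 : sup E <= s N + e / 2 by apply: ge_sup => //; exists (s N - e / 2).
by rewrite !ltr_norml => /andP[h3 h4]; apply/andP; split; lra.
Qed.

Lemma complex_cauchy_converges (s : nat -> C) :
  (forall e, 0 < e -> exists N, forall m n, (N <= m)%N -> (N <= n)%N -> normc (s m - s n) < e) ->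
  exists l, forall e, 0 < e -> exists N, forall n, (N <= n)%N -> normc (s n - l) < e.
Proof.
move=> cs.
have [|p hp] := @real_cauchy_converges (fun n => complex.Re (s n)).
  move=> e /cs[N hN]; exists N => m n Nm Nn; apply: le_lt_trans (hN m n Nm Nn).
  by rewrite -ReN -ReD normc_Re.
have [|q hq] := @real_cauchy_converges (fun n => complex.Im (s n)).
  move=> e /cs[N hN]; exists N => m n Nm Nn; apply: le_lt_trans (hN m n Nm Nn).
  by rewrite -ImN -ImD normc_Im.
exists (Complex p q) => e e0; have e2 : 0 < e / 2 by lra.
have [N1 h1] := hp _ e2; have [N2 h2] := hq _ e2.
exists (maxn N1 N2) => n; rewrite geq_max => /andP[/h1 + /h2].
move=> a1 a2; apply: le_lt_trans (normc_le_ReIm _) _.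
by rewrite ReD ImD ReN ImN /=; lra.
Qed.

Definition complex_ip (u v : C^o) : C := u * conjc v.

Lemma complex_ip_norm (u : C^o) : hnorm_of complex_ip u = normc u.
Proof. by rewrite /hnorm_of /complex_ip mulcJ /= sqrtr_sqr ger0_norm ?normc_ge0. Qed.

Lemma complex_ip_hilbert : is_hilbert complex_ip.
Proof.
split.
- by move=> a u v w; rewrite /complex_ip mulrDl -mulrA.
- by move=> u v; rewrite /complex_ip rmorphM /= conjcK mulrC.
- by move=> u; rewrite /complex_ip mulcJ ler0c sqr_ge0.
- move=> u; rewrite /complex_ip mulcJ => /complexI/eqP.
  by rewrite sqrf_eq0 => /eqP/ComplexField.Normc.eq0_normc.
- move=> s cs; have [|l hl] := @complex_cauchy_converges s.
    move=> e /cs[N hN]; exists N => m n Nm Nn.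
    by have := hN m n Nm Nn; rewrite complex_ip_norm.
  by exists l => e /hl[N hN]; exists N => n /hN; rewrite complex_ip_norm.
Qed.

Definition complex_hilbert : hilbert R := Hilbert complex_ip_hilbert.

End Completeness.

Section ExtensionProperty.
Variables (R : realType) (H : hilbert R).
Local Notation C := (complex R).

(* The character [p(a^2) |-> p(-1)] of the algebra generated by [a^2] does not
   extend, since [a^2] must be represented by a positive operator. *)
Lemma Estar_algebraic (A : (H -> H) -> Prop) (a : H -> H) : star_subalg A ->
  property_Estar A -> A a -> self_adjoint a -> algebraic a.
Proof.
move=> sA hE Aa sa; have [[bA _ _ _ AM] _] := sA; have ba := bA _ Aa.
apply: algebraic_sqr => //; apply: contrapT => nc.
set c := mul_op a a in nc; have Ac : A c by apply: AM.
have bc : bop c by apply: bA.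
have sc : self_adjoint c by apply: adj_mul_self.
have gA x : gen_subalg c x -> A x by apply=> //; case: sA.
have gc := @gen_self R H c.
have pc : poly_of c c = 'X by apply: poly_of_self.
pose ev x : C := (poly_of c x).[-1].
pose pi (x : H -> H) : complex_hilbert R -> complex_hilbert R := fun z : C^o => ev x * z.
have hpi : star_hom (gen_subalg c) pi.
  split.
  - move=> x _; split.
      by move=> d u v; rewrite /pi /= mulrDr; congr (_ + _); rewrite mulrCA.
    exists (normc (ev x)) => u; rewrite /hnorm !complex_ip_norm.
    by rewrite ComplexField.Normc.normcM.
  - move=> x y gx gy; apply/funext => u.
    by rewrite /pi /ev /add_op poly_of_add // hornerD mulrDl.
  - move=> d x gx; apply/funext => u.
    by rewrite /pi /ev /scale_op poly_of_scale // hornerZ -mulrA.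
  - move=> x y gx gy; apply/funext => u.
    by rewrite /pi /ev /mul_op poly_of_mul // hornerM -mulrA.
  - move=> x y gx gy xy u v; rewrite /pi /ev (poly_of_adj bc sc nc gx xy).
    rewrite -{2}(conjcN1 R) horner_map /= /complex_ip rmorphM /= conjcK.
    by rewrite -mulrA mulrCA.
have cyc : cyclic_vec (gen_subalg c) pi (1 : C^o).
  (* [c] acts as -1, so this multiple of [c] sends 1 exactly to [u]. *)
  move=> u e e0; exists (scale_op (- (u : C)) c).
    by move=> S sS Sc; case: (sS) => _ _ _ SZ _; exact: SZ.
  rewrite /pi /ev poly_of_scale // pc.
  by rewrite hornerZ hornerX mulrN1 opprK mulr1 subrr hnorm0.
have [K2 [pi0 [w [hpi0 _ hw]]]] := hE _ (gen_subalg_star bc sc) gA _ pi _ hpi cyc.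
have := hw c gc.
have [_ _ _ pi0M pi0s] := hpi0.
(* [c = a a] factors in [A], so the right-hand side is |pi0(a) w|^2, while the left-hand side is
   -1. *)
rewrite [pi0 c]pi0M // /mul_op (pi0s a a) // (ip_nrm (hilbert_semi K2)).
rewrite /pi /ev pc hornerX /= /complex_ip conjc1 !mulr1.
move=> /(congr1 (@complex.Re R)) /=; have := sqr_ge0 (hnorm (pi0 a w)).
by rewrite /hnorm; lra.
Qed.

End ExtensionProperty.

(** * The Hahn-Banach theorem *)

Section HahnBanach.
Variables (R : realType) (V : lmodType R) (p : V -> R).
Hypothesis p_sub : forall x y, p (x + y) <= p x + p y.
Hypothesis p_hom : forall (t : R) x, 0 <= t -> p (t *: x) = t * p x.

(* Partial linear functionals dominated by [p] are handled as graphs; domination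
   at [0] makes such a graph functional. *)
Definition dominated_graph (G : set (V * R)) : Prop :=
  (forall t x y r s, G (x, r) -> G (y, s) -> G (t *: x + y, t * r + s)) /\
  (forall x r, G (x, r) -> r <= p x).

(** The value at [x0] must lie above every [r - p (x - x0)] and below every [p (y + x0) - s];
    subadditivity makes this consistent, and the supremum of the lower constraints is chosen. *)
Lemma dominated_graph_extend (G : set (V * R)) x0 : dominated_graph G -> G (0, 0) ->
  exists G', [/\ dominated_graph G', (G `<=` G')%classic & exists c, G' (x0, c)].
Proof.
move=> [GL Gp] G0.
have GZ t x r : G (x, r) -> G (t *: x, t * r).
  by move=> Gx; have := GL t _ _ _ _ Gx G0; rewrite !addr0.
pose S := [set c | exists x r, G (x, r) /\ c = r - p (x - x0)]%classic.
have key x y r s : G (x, r) -> G (y, s) -> r - p (x - x0) <= p (y + x0) - s.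
  move=> Gx Gy; have := GL 1 _ _ _ _ Gx Gy; rewrite scale1r mul1r => /Gp h.
  have := p_sub (x - x0) (y + x0); rewrite addrACA addNr addr0; lra.
have Sn : (S !=set0)%classic by exists (0 - p (0 - x0)), 0, 0.
have Sle y s : G (y, s) -> sup S <= p (y + x0) - s.
  by move=> Gy; apply: ge_sup => // _ [x [r [Gx ->]]]; apply: key.
have Sge x r : G (x, r) -> r - p (x - x0) <= sup S.
  move=> Gx; apply: ub_le_sup; last by exists x, r.
  by exists (p (0 + x0) - 0) => _ [x' [r' [Gx' ->]]]; apply: key.
exists [set z | exists t x r, [/\ G (x, r), z.1 = x + t *: x0 & z.2 = r + t * sup S]]%classic.
split; last first.
- by exists (sup S), 1, 0, 0; split; rewrite //= add0r ?scale1r ?mul1r.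
- by move=> [x r] Gx; exists 0, x, r; split; rewrite //= ?scale0r ?mul0r addr0.
split=> [t _ _ _ _ [t1 [x1 [r1 [G1 /= -> ->]]]] [t2 [x2 [r2 [G2 /= -> ->]]]]|].
  exists (t * t1 + t2), (t *: x1 + x2), (t * r1 + r2); split; first exact: GL.
    by rewrite /= scalerDr scalerDl scalerA addrACA.
  by rewrite /=; ring.
move=> _ _ [t [x [r [Gx /= -> ->]]]].
(* Rescaling by the inverse of |t| reduces to the coefficients -1 and 1, covered by [Sge] and
   [Sle]. *)
have [t0|t0|->] := ltgtP t 0; last by rewrite scale0r mul0r !addr0; apply: Gp.
- have s0 : 0 < - t by rewrite oppr_gt0.
  have := Sge _ _ (GZ (- t)^-1 _ _ Gx); rewrite -(ler_pM2l s0) => h.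
  have pE : p (x + t *: x0) = - t * p ((- t)^-1 *: x - x0).
    rewrite -p_hom ?ltW // scalerBr scalerA mulfV ?gt_eqF // scale1r scaleNr opprK //.
  have e : - t * ((- t)^-1 * r - p ((- t)^-1 *: x - x0)) = r - - t * p ((- t)^-1 *: x - x0).
    by rewrite mulrBr mulrA mulfV ?gt_eqF // mul1r.
  by move: h; rewrite e pE; lra.
- have := Sle _ _ (GZ t^-1 _ _ Gx); rewrite -(ler_pM2l t0) => h.
  have pE : p (x + t *: x0) = t * p (t^-1 *: x + x0).
    by rewrite -p_hom ?ltW // scalerDr scalerA mulfV ?gt_eqF // scale1r.
  have e : t * (p (t^-1 *: x + x0) - t^-1 * r) = t * p (t^-1 *: x + x0) - r.
    by rewrite mulrBr mulrA mulfV ?gt_eqF // mul1r.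
  by move: h; rewrite e pE; lra.
Qed.

Lemma hahn_banach (F : set V) (f : V -> R) : F 0 ->
  (forall t x y, F x -> F y -> F (t *: x + y) /\ f (t *: x + y) = t * f x + f y) ->
  (forall x, F x -> f x <= p x) ->
  exists g : V -> R, [/\ forall t x y, g (t *: x + y) = t * g x + g y,
    forall x, g x <= p x & forall x, F x -> g x = f x].
Proof.
move=> F0 fL fp.
pose G0 := [set z : V * R | F z.1 /\ z.2 = f z.1]%classic.
have G0d : dominated_graph G0.
  split=> [t x y r s [/= Fx ->] [/= Fy ->]|x r [/= Fx ->]]; last exact: fp.
  by have [? e] := fL t _ _ Fx Fy; split.
have f0 : f 0 = 0.
  have := (fL 1 0 0 F0 F0).2; rewrite scaler0 addr0; lra.
have G00 : G0 (0, 0) by split.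
pose P := [set G : set (V * R) | dominated_graph G /\ (G = set0 \/ (G0 `<=` G))]%classic.
have [G [[Gd Gc] Gm]] : exists A, P A /\ forall B, (A `<` B)%classic -> ~ P B.
  apply: Zorn_bigcup => Fam sP tot; split.
    split=> [t x y r s [G1 F1 G1x] [G2 F2 G2x]|x r [G1 F1 G1x]]; last first.
      by have [[_ +] _] := sP _ F1; apply.
    have [h|h] := tot _ _ F1 F2.
      by exists G2 => //; have [[+ _] _] := sP _ F2; apply => //; apply: h.
    by exists G1 => //; have [[+ _] _] := sP _ F1; apply => //; apply: h.
  have [[G1 F1 G1c]|hn] := pselect (exists2 G1, Fam G1 & (G0 `<=` G1)%classic).
    by right=> z /G1c; exists G1.
  left; rewrite -subset0 => z [G1 F1 G1z].
  have [_ [G10|h]] := sP _ F1; first by rewrite -G10.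
  by exfalso; apply: hn; exists G1.
have Gs : (G0 `<=` G)%classic.
  case: Gc => // Ge; exfalso; apply: (Gm G0); last by split; [|right].
  by rewrite Ge; split=> // h; apply: (h _ G00).
have GG := Gs _ G00; have [GL Gp] := Gd.
have tot x : exists r, G (x, r).
  have [G' [G'd GG' [c G'c]]] := dominated_graph_extend x Gd GG.
  have [G'G|ne] := pselect (G' `<=` G)%classic; first by exists c; apply: G'G.
  by exfalso; apply: (Gm G'); split=> //; right=> z /Gs/GG'.
have p0 : p 0 = 0 by rewrite -(scale0r 0) p_hom // mul0r.
have fn x r s : G (x, r) -> G (x, s) -> r = s.
  move=> h1 h2; apply/eqP; rewrite eq_le; apply/andP; split.
    have := GL (-1) _ _ _ _ h2 h1; rewrite scaleN1r addNr mulN1r => /Gp; rewrite p0; lra.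
  have := GL (-1) _ _ _ _ h1 h2; rewrite scaleN1r addNr mulN1r => /Gp; rewrite p0; lra.
have /choice[g hg] := tot; exists g; split.
- by move=> t x y; apply: (fn (t *: x + y)) => //; apply: GL.
- by move=> x; apply: Gp.
- by move=> x Fx; apply: (fn x) => //; apply: Gs.
Qed.

End HahnBanach.

(** * The dual of a semi-inner product space *)

Definition submodule_prop (K : pzRingType) (W : lmodType K) (P : W -> Prop) : Prop :=
  P 0 /\ forall a u v, P u -> P v -> P (a *: u + v).

Section Submodule.
Variables (K : pzRingType) (W : lmodType K) (P : W -> Prop) (hP : submodule_prop P).

(** The closure proof is an argument so that the instance below can recover it from the
    predicate. *)
Definition submod_pred of submodule_prop P : {pred W} := fun x => `[< P x >].

Fact submod_pred_closed : submod_closed (submod_pred hP).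
Proof.
split; first by apply/asboolP; case: hP.
by move=> a u v /asboolP Pu /asboolP Pv; apply/asboolP; case: hP => _; apply.
Qed.

HB.instance Definition _ :=
  GRing.isSubmodClosed.Build K W (submod_pred hP) submod_pred_closed.

Record submod := Submod { submod_val : W; submod_mem : submod_val \in submod_pred hP }.

HB.instance Definition _ := [isSub for submod_val].
HB.instance Definition _ := [Choice of submod by <:].
HB.instance Definition _ := [SubChoice_isSubLmodule of submod by <:].

Lemma submodP (x : submod) : P (submod_val x).
Proof. by case: x => v /= /asboolP. Qed.

Definition to_submod (w : W) (Pw : P w) : submod :=
  Submod (introT (asboolP (P w)) Pw : w \in submod_pred hP).

Lemma submod_val_inj : injective submod_val.
Proof. exact: val_inj. Qed.

Lemma submod_val_lin a (x y : submod) :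
  submod_val (a *: x + y) = a *: submod_val x + submod_val y.
Proof. by []. Qed.

End Submodule.

(** * Limits of complex sequences *)

Section ComplexSequences.
Variable R : realType.
Local Notation C := (complex R).
Implicit Types (s t : nat -> C) (l m : C).

Definition conv s l : Prop :=
  forall e : R, 0 < e -> exists N, forall n, (N <= n)%N -> normc (s n - l) < e.

(** The rate [K / n.+1] is the error left by [riesz_seq] on vectors of norm at most [K]. *)
Lemma conv_close s t l (K : R) : 0 <= K ->
  (forall n, normc (s n - t n) <= K / n.+1%:R) -> conv s l -> conv t l.
Proof.
move=> K0 hK cs e e0; have e2 : 0 < e / 2 by lra.
have [N hN] := cs _ e2.
have [M hM] : exists M : nat, forall n, (M <= n)%N -> K / n.+1%:R < e / 2.
  have k0 : 0 <= K / (e / 2) by rewrite divr_ge0 // ltW.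
  exists (Num.bound (K / (e / 2))) => n hn; rewrite ltr_pdivrMr ?ltr0n // mulrC.
  rewrite -ltr_pdivrMr //; have := archi_boundP k0; move=> /lt_le_trans; apply.
  by rewrite ler_nat ltnW.
exists (maxn N M) => n; rewrite geq_max => /andP[/hN h1 /hM h2].
have -> : t n - l = (s n - l) - (s n - t n) by ring.
apply: le_lt_trans (le_normcD _ _) _; rewrite normcN.
have := le_lt_trans (hK n) h2; lra.
Qed.

Lemma conv_const l : conv (fun=> l) l.
Proof. by move=> e e0; exists 0%N => n _; rewrite subrr ComplexField.Normc.normc0. Qed.

Lemma conv_lin a s t l m : conv s l -> conv t m -> conv (fun n => a * s n + t n) (a * l + m).
Proof.
move=> cs ct e e0; have a0 : 0 < normc a + 1 by rewrite ltr_wpDl ?normc_ge0.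
have e1 : 0 < e / 2 / (normc a + 1) by rewrite divr_gt0 //; lra.
have e2 : 0 < e / 2 by lra.
have [N hN] := cs _ e1; have [M hM] := ct _ e2.
exists (maxn N M) => n; rewrite geq_max => /andP[/hN h1 /hM h2].
rewrite opprD addrACA -mulrBr; apply: le_lt_trans (le_normcD _ _) _.
rewrite ComplexField.Normc.normcM.
have h3 : normc a * normc (s n - l) <= e / 2.
  move: h1; rewrite ltr_pdivlMr // => h1; apply: le_trans (ltW h1).
  by rewrite mulrC ler_wpM2l ?normc_ge0 // lerDl.
lra.
Qed.

Lemma conv_conj s l : conv s l -> conv (fun n => conjc (s n)) (conjc l).
Proof. by move=> cs e /cs[N hN]; exists N => n /hN; rewrite -rmorphB /= normc_conj. Qed.

Lemma conv_near_le s l m (K : R) : conv s l ->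
  (exists N, forall n, (N <= n)%N -> normc (s n - m) <= K) -> normc (l - m) <= K.
Proof.
move=> cs [M hM]; rewrite leNgt; apply/negP => h.
have e0 : 0 < normc (l - m) - K by lra.
have [N hN] := cs _ e0.
have h1 := hN _ (leq_maxl N M); have h2 := hM _ (leq_maxr N M).
have : normc (l - m) <= normc (s (maxn N M) - l) + normc (s (maxn N M) - m).
  rewrite -(normcN (s (maxn N M) - l)); apply: le_trans (le_normcD _ _).
  by rewrite opprB addrA subrK.
lra.
Qed.

Lemma conv_unique s l m : conv s l -> conv s m -> l = m.
Proof.
move=> cl cm; apply/eqP; rewrite -subr_eq0; apply/eqP/ComplexField.Normc.eq0_normc.
apply/eqP; rewrite eq_le normc_ge0 andbT leNgt; apply/negP => h.
have h2 : 0 < normc (l - m) / 2 by lra.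
have : normc (l - m) <= normc (l - m) / 2.
  by apply: conv_near_le cl _; have [N hN] := cm _ h2; exists N => n /hN/ltW.
lra.
Qed.

Lemma conv_ge0 s l : conv s l -> (forall n, 0 <= s n) -> 0 <= l.
Proof.
move=> cs s0.
have near e : 0 < e -> `|complex.Im l| < e /\ - e < complex.Re l.
  move=> /cs[N /(_ N (leqnn N)) hN].
  have := s0 N; rewrite lecE /= => /andP[/eqP im0 re0].
  have := le_lt_trans (normc_Im _) hN; have := le_lt_trans (normc_Re _) hN.
  rewrite ReD ImD ReN ImN im0 sub0r normrN => h1 h2; split=> //.
  by move: h1; rewrite ltr_norml => /andP[]; lra.
rewrite lecE /=; apply/andP; split.
  rewrite -normr_eq0; apply: contraT => h.
  have /near[] : 0 < `|complex.Im l| by rewrite lt_neqAle eq_sym h normr_ge0.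
  by rewrite ltxx.
rewrite leNgt; apply/negP => h; have /near[_] : 0 < - complex.Re l by lra.
by rewrite opprK ltxx.
Qed.

End ComplexSequences.

Section DualHilbert.
Variables (R : realType) (V : lmodType (complex R)) (ip : V -> V -> complex R).
Local Notation C := (complex R).
Local Notation nrm := (hnorm_of ip).

Definition bounded_antilinear (xi : V -> C^o) : Prop :=
  (forall c x y, xi (c *: x + y) = conjc c * xi x + xi y) /\
  exists2 K : R, 0 <= K & forall y, normc (xi y) <= K * nrm y.

Fact bounded_antilinear_submod : submodule_prop bounded_antilinear.
Proof.
split.
  have z y : (0 : V -> C^o) y = 0 by [].
  split=> [c x y|]; first by rewrite !z mulr0 addr0.
  by exists 0 => // y; rewrite z mul0r ComplexField.Normc.normc0.
move=> a xi eta [xiL [K K0 hK]] [etaL [M M0 hM]]; split.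
  move=> c x y; rewrite !addrfctE !scalrfctE xiL etaL.
  by rewrite !scalerDr mulrDr addrACA; congr (_ + _ + _); rewrite /GRing.scale /= mulrCA.
exists (normc a * K + M) => [|y]; first by rewrite addr_ge0 ?mulr_ge0 ?normc_ge0.
rewrite [X in normc X](_ : _ = a * xi y + eta y) //; apply: le_trans (le_normcD _ _) _.
by rewrite ComplexField.Normc.normcM mulrDl lerD // -mulrA ler_wpM2l ?normc_ge0.
Qed.

(* [dual] models the Hilbert completion of [V], [x] being sent to [ip x _]; an
   operator with formal adjoint [T] acts on it as [xi |-> xi \o T]. *)
Definition dual := submod bounded_antilinear_submod.
HB.instance Definition _ := GRing.Lmodule.on dual.

Definition dapp (xi : dual) (y : V) : C := submod_val xi y.

Lemma dappD (xi : dual) c x y : dapp xi (c *: x + y) = conjc c * dapp xi x + dapp xi y.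
Proof. by case: (submodP xi) => h _; apply: h. Qed.

Lemma dapp_lin c (xi eta : dual) y : dapp (c *: xi + eta) y = c * dapp xi y + dapp eta y.
Proof. by []. Qed.

Lemma dappZl c (xi : dual) y : dapp (c *: xi) y = c * dapp xi y.
Proof. by []. Qed.

Lemma dapp_ext (xi eta : dual) : (forall y, dapp xi y = dapp eta y) -> xi = eta.
Proof. by move=> h; apply: submod_val_inj; apply/funext. Qed.

Lemma dapp_bound (xi : dual) : exists2 K : R, 0 <= K & forall y, normc (dapp xi y) <= K * nrm y.
Proof. by case: (submodP xi). Qed.

Hypothesis ipP : semi_inner ip.

Lemma dapp0r (xi : dual) : dapp xi 0 = 0.
Proof.
have := dappD xi (-1) 0 0; rewrite scaler0 addr0 conjcN1 mulN1r addNr //.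
Qed.
Lemma dappB (xi : dual) x y : dapp xi (x - y) = dapp xi x - dapp xi y.
Proof. by rewrite addrC -scaleN1r dappD conjcN1 mulN1r addrC. Qed.
Lemma dappZ (xi : dual) c x : dapp xi (c *: x) = conjc c * dapp xi x.
Proof. by rewrite -[_ *: _]addr0 dappD dapp0r addr0. Qed.

Fact ip_bounded_antilinear x : bounded_antilinear (fun y => ip x y).
Proof.
split=> [c y z|]; first by rewrite (ipDr ipP) (ipZr ipP).
by exists (nrm x) => [|y]; [apply: nrm_ge0 | apply: cauchy_schwarz].
Qed.

Definition dual_of (x : V) : dual := to_submod bounded_antilinear_submod (ip_bounded_antilinear x).

Lemma dual_ofE x y : dapp (dual_of x) y = ip x y. Proof. by []. Qed.

(* A near-minimizer of [|x|^2 - 2 Re xi(x)] nearly represents [xi]. *)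
Lemma riesz_approx (xi : dual) (e : R) : 0 < e ->
  exists x, forall y, normc (dapp xi y - ip x y) <= e * nrm y.
Proof.
move=> e0; have [K K0 hK] := dapp_bound xi.
pose J x := nrm x ^+ 2 - 2 * complex.Re (dapp xi x).
pose E := [set r | exists x, r = J x]%classic.
have Elb : has_lbound E.
  exists (- K ^+ 2) => _ [x ->]; rewrite /J.
  have := le_trans (ler_Re_normc _) (hK x); have := sqr_ge0 (nrm x - K).
  rewrite sqrrB -mulr_natl; lra.
have En : (E !=set0)%classic by exists (J 0), 0.
have e2 : 0 < e ^+ 2 by rewrite exprn_gt0.
have [_ [x ->] hx] := inf_adherent e2 (conj En Elb).
have Jge y : inf E <= J y by apply: ge_inf => //; exists y.
exists x => y.
have [z nz hz] := complex_phase (dapp xi y - ip x y).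
(* [J (x + t w) - J x = 2 t Re (ip x w - xi w) + t^2 |w|^2] stays above [- e ^+ 2], so its
   discriminant bounds the linear coefficient. *)
have re w : complex.Re (ip x w - dapp xi w) ^+ 2 <= e ^+ 2 * nrm w ^+ 2.
  apply: discriminant_le; rewrite ?sqr_ge0 // => t.
  have := Jge (x + t%:C *: w); move: hx; rewrite /J (nrm_sqrD ipP) (nrmZ ipP) exprMn.
  rewrite normc_real real_normK ?num_real // (ipZr ipP) conjc_real ReMr.
  rewrite [x + _]addrC dappD conjc_real !ReD ReMr ReN; lra.
have := re (conjc z *: y).
rewrite (ipZr ipP) dappZ conjcK -mulrBr -opprB mulrN hz ReN /= sqrrN -exprMn (nrmZ ipP).
rewrite normc_conj nz mul1r ler_sqr // nnegrE ?normc_ge0 //.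
by rewrite mulr_ge0 ?nrm_ge0 // ltW.
Qed.

(** [V] need not be complete, so [xi] may have no exact representative; this Cauchy sequence stands
    for it. *)
Definition riesz_seq (xi : dual) (n : nat) : V :=
  xget 0 [set x | forall y, normc (dapp xi y - ip x y) <= n.+1%:R^-1 * nrm y]%classic.

Lemma riesz_seqP xi n y : normc (dapp xi y - ip (riesz_seq xi n) y) <= n.+1%:R^-1 * nrm y.
Proof.
have [|x hx] := @riesz_approx xi n.+1%:R^-1; first by rewrite invr_gt0 ltr0n.
by rewrite /riesz_seq; case: xgetP => [v _|/(_ x)]; [apply | case].
Qed.

Lemma riesz_seq_cauchy xi m n :
  nrm (riesz_seq xi m - riesz_seq xi n) <= m.+1%:R^-1 + n.+1%:R^-1.
Proof.
set d := _ - _; have [->|d0] := eqVneq (nrm d) 0.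
  by rewrite addr_ge0 ?invr_ge0 ?ler0n.
have dp : 0 < nrm d by rewrite lt_neqAle eq_sym d0 nrm_ge0.
rewrite -(ler_pM2r dp) -expr2 (nrm_sqr ipP) {1}/d (ipBl ipP).
apply: le_trans (ler_Re_normc _) _; rewrite mulrDl.
have -> : ip (riesz_seq xi m) d - ip (riesz_seq xi n) d =
  - (dapp xi d - ip (riesz_seq xi m) d) + (dapp xi d - ip (riesz_seq xi n) d).
  by rewrite opprB addrA subrK.
by apply: le_trans (le_normcD _ _) _; rewrite normcN lerD ?riesz_seqP.
Qed.

Lemma riesz_seq_bounded xi : exists2 K : R, 0 <= K & forall n, nrm (riesz_seq xi n) <= K.
Proof.
exists (nrm (riesz_seq xi 0) + 2) => [|n]; first by rewrite addr_ge0 ?nrm_ge0.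
rewrite -[riesz_seq xi n](subrK (riesz_seq xi 0)) addrC.
apply: le_trans (nrm_triangle ipP _ _) _; rewrite lerD2l.
apply: le_trans (riesz_seq_cauchy _ _ _) _; rewrite invr1.
have : n.+1%:R^-1 <= 1 :> R by rewrite invf_le1 ?ltr0n // ler1n.
by move: (n.+1%:R^-1) => z; lra.
Qed.

(** The form [ip] extended by continuity; only the second argument is approximated, as [xi] already
    acts on [V]. *)
Definition dip (xi eta : dual) : C :=
  xget 0 [set l | conv (fun n => dapp xi (riesz_seq eta n)) l]%classic.

Lemma inv_small (e : R) : 0 < e -> exists N : nat, forall n, (N <= n)%N -> n.+1%:R^-1 < e.
Proof.
move=> e0; have k0 : 0 <= e^-1 by rewrite invr_ge0 ltW.
exists (Num.bound e^-1) => n hn; rewrite invf_plt ?posrE ?ltr0n //.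
by apply: lt_le_trans (archi_boundP k0) _; rewrite ler_nat ltnW.
Qed.

Lemma dipP xi eta : conv (fun n => dapp xi (riesz_seq eta n)) (dip xi eta).
Proof.
suff [l hl] : exists l, conv (fun n => dapp xi (riesz_seq eta n)) l.
  by rewrite /dip; case: xgetP => [v _ //|/(_ l)]; case.
apply: complex_cauchy_converges => e e0; have [K K0 hK] := dapp_bound xi.
have K1 : 0 < K + 1 by rewrite ltr_wpDl.
have e1 : 0 < e / 2 / (K + 1) by rewrite divr_gt0 //; lra.
have [N hN] := inv_small e1; exists N => m n /hN hm /hN hn.
rewrite -dappB; apply: le_lt_trans (hK _) _.
have h := riesz_seq_cauchy eta m n.
have h2 : (K + 1) * (e / 2 / (K + 1)) = e / 2 by rewrite mulrC divfK // gt_eqF.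
have h3 : K * nrm (riesz_seq eta m - riesz_seq eta n) <=
  (K + 1) * (m.+1%:R^-1 + n.+1%:R^-1).
  by apply: ler_pM; rewrite ?nrm_ge0 // lerDl.
apply: le_lt_trans h3 _; rewrite mulrDr.
have := hm; rewrite -(ltr_pM2l K1) h2; have := hn; rewrite -(ltr_pM2l K1) h2.
by move: (m.+1%:R^-1) (n.+1%:R^-1) => p q; lra.
Qed.

Lemma dip_unique xi eta l : conv (fun n => dapp xi (riesz_seq eta n)) l -> dip xi eta = l.
Proof. exact: conv_unique (dipP _ _). Qed.

Lemma dip_self xi : conv (fun n => ip (riesz_seq xi n) (riesz_seq xi n)) (dip xi xi).
Proof.
have [K K0 hK] := riesz_seq_bounded xi.
apply: conv_close K0 _ (dipP xi xi) => n; apply: le_trans (riesz_seqP _ _ _) _.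
by rewrite mulrC ler_wpM2r ?invr_ge0 ?ler0n.
Qed.

Lemma dip_semi_inner : semi_inner dip.
Proof.
split.
- move=> a u v w; apply: dip_unique.
  exact: (conv_lin a (dipP u w) (dipP v w)).
- move=> u v; apply: dip_unique.
  have [K K0 hK] := riesz_seq_bounded u; have [M M0 hM] := riesz_seq_bounded v.
  apply: conv_close (addr_ge0 K0 M0) _ (conv_conj (dipP v u)) => n.
  have -> : conjc (dapp v (riesz_seq u n)) - dapp u (riesz_seq v n) =
    conjc (dapp v (riesz_seq u n) - ip (riesz_seq v n) (riesz_seq u n)) +
    - (dapp u (riesz_seq v n) - ip (riesz_seq u n) (riesz_seq v n)).
    by rewrite rmorphB /= -(ipC ipP) opprB addrA subrK.
  apply: le_trans (le_normcD _ _) _; rewrite normcN normc_conj mulrDl.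
  apply: lerD; apply: le_trans (riesz_seqP _ _ _) _;
    by rewrite mulrC ler_wpM2r ?invr_ge0 ?ler0n.
- by move=> u; apply: conv_ge0 (dip_self u) _ => n; case: ipP.
Qed.

Local Notation dnrm := (hnorm_of dip).

(** Reproducing property: the approximants of [dual_of y] lie within [1 / n.+1] of [y]. *)
Lemma dip_dual_of xi y : dip xi (dual_of y) = dapp xi y.
Proof.
apply: dip_unique; have [K K0 hK] := dapp_bound xi.
apply: (conv_close K0 _ (conv_const (dapp xi y))) => n; rewrite -dappB.
apply: le_trans (hK _) _; rewrite ler_wpM2l //.
set d := y - _; have [->|d0] := eqVneq (nrm d) 0; first by rewrite invr_ge0 ler0n.
have dp : 0 < nrm d by rewrite lt_neqAle eq_sym d0 nrm_ge0.
rewrite -(ler_pM2r dp) -expr2 (nrm_sqr ipP) {1}/d (ipBl ipP).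
by apply: le_trans (ler_Re_normc _) _; rewrite -dual_ofE riesz_seqP.
Qed.

Lemma dnrm_dual_of x : dnrm (dual_of x) = nrm x.
Proof. by rewrite /hnorm_of dip_dual_of. Qed.

Lemma dapp_le_dnrm xi y : normc (dapp xi y) <= dnrm xi * nrm y.
Proof. by rewrite -dip_dual_of -dnrm_dual_of; apply: cauchy_schwarz dip_semi_inner _ _. Qed.

Lemma dnrm_le xi (K : R) : 0 <= K -> (forall y, normc (dapp xi y) <= K * nrm y) -> dnrm xi <= K.
Proof.
move=> K0 hK; rewrite -ler_sqr ?nnegrE ?nrm_ge0 // (nrm_sqr dip_semi_inner).
rewrite leNgt; apply/negP => h.
set D := complex.Re _ in h.
(* The estimates below give [D - K ^+ 2 < 3 * e] for the error [e], so a quarter is small enough. *)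
have e0 : 0 < (D - K ^+ 2) / 4 by lra.
have [N hN] := dipP xi xi e0; have [M hM] := dip_self xi e0.
set n := maxn N M.
have := le_lt_trans (normc_Re _) (hN n (leq_maxl _ _)).
have := le_lt_trans (normc_Re _) (hM n (leq_maxr _ _)).
rewrite !ReD !ReN -/D -(nrm_sqr ipP) !ltr_norml => /andP[a1 a2] /andP[b1 b2].
have c1 := le_trans (ler_Re_normc _) (hK (riesz_seq xi n)).
have := sqr_ge0 (nrm (riesz_seq xi n) - K); rewrite sqrrB -mulr_natl; lra.
Qed.

Lemma dual_of_dense xi (e : R) : 0 < e -> exists x, dnrm (dual_of x - xi) < e.
Proof.
move=> e0; have e2 : 0 < e / 2 by lra.
have [x hx] := riesz_approx xi e2; exists x.
apply: le_lt_trans (_ : e / 2 < e); last by lra.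
apply: dnrm_le (ltW e2) _ => y.
have -> : dapp (dual_of x - xi) y = - (dapp xi y - ip x y) by rewrite opprB.
by rewrite normcN.
Qed.

Lemma dip_hilbert : is_hilbert dip.
Proof.
have [h1 h2 h3] := dip_semi_inner; split=> //.
  move=> xi xi0; apply: dapp_ext => y; apply: ComplexField.Normc.eq0_normc.
  apply/eqP; rewrite eq_le normc_ge0 andbT.
  by have := dapp_le_dnrm xi y; rewrite /hnorm_of xi0 sqrtr0 mul0r.
move=> s cs.
have dB m n y : dapp (s m - s n) y = dapp (s m) y - dapp (s n) y by [].
(* A Cauchy sequence of functionals converges pointwise, and uniformly relative to [nrm y]; the
   pointwise limit is the limit in norm. *)
have pw y : exists l, conv (fun n => dapp (s n) y) l.
  apply: complex_cauchy_converges => e e0.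
  have n1 : 0 < nrm y + 1 by rewrite ltr_wpDl ?nrm_ge0.
  have [N hN] := cs _ (divr_gt0 e0 n1); exists N => m n Nm Nn.
  rewrite -dB; apply: le_lt_trans (dapp_le_dnrm _ _) _.
  have := hN _ _ Nm Nn; rewrite ltr_pdivlMr //; apply: le_lt_trans.
  by rewrite ler_wpM2l ?nrm_ge0 // lerDl.
have /choice[l hl] := pw.
have near e : 0 < e -> exists N, forall n, (N <= n)%N -> forall y,
    normc (l y - dapp (s n) y) <= e * nrm y.
  move=> /cs[N hN]; exists N => n Nn y; apply: conv_near_le (hl y) _.
  exists N => m Nm; rewrite -dB; apply: le_trans (dapp_le_dnrm _ _) _.
  by rewrite ler_wpM2r ?nrm_ge0 // ltW // hN.
have lb : bounded_antilinear l.
  split=> [c x y|].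
    apply: (conv_unique (hl _)).
    have := conv_lin (conjc c) (hl x) (hl y).
    by congr (conv _ _); apply/funext => n; rewrite dappD.
  have [N /(_ N (leqnn N)) hN] := near 1 ltr01.
  exists (1 + dnrm (s N)) => [|y]; first by rewrite addr_ge0 ?nrm_ge0.
  rewrite -[l y](subrK (dapp (s N) y)); apply: le_trans (le_normcD _ _) _.
  by rewrite mulrDl lerD ?dapp_le_dnrm.
exists (to_submod bounded_antilinear_submod lb) => e e0.
have e2 : 0 < e / 2 by lra.
have [N hN] := near _ e2; exists N => n Nn.
apply: le_lt_trans (_ : e / 2 < e); last by lra.
apply: dnrm_le (ltW e2) _ => y.
rewrite [X in normc X](_ : _ = - (l y - dapp (s n) y)); last by rewrite opprB.
by rewrite normcN hN.
Qed.

Definition dual_hilbert : hilbert R := Hilbert dip_hilbert.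

End DualHilbert.

(** * The Gelfand-Naimark-Segal construction *)

Section GNS.
Variables (R : realType) (H : hilbert R) (A : (H -> H) -> Prop).
Local Notation C := (complex R).
Let HP := hilbert_semi H.
Hypothesis sA : star_subalg A.
Implicit Types x : H -> H.

Fact subalg_submod : submodule_prop (W := H -> H) A.
Proof. by case: sA => -[_ A0 AD AZ _] _; split=> // a u v Au Av; apply: AD => //; apply: AZ. Qed.

Local Notation V := (submod subalg_submod).
Local Notation "\v x" := (@submod_val _ _ _ subalg_submod x) (at level 8, format "\v x").

Let bA x : A x -> bop x. Proof. by case: sA => -[+ _ _ _ _] _; apply. Qed.
Let AD x y : A x -> A y -> A (add_op x y). Proof. by case: sA => -[_ _ + _ _] _; apply. Qed.
Let AZ c x : A x -> A (scale_op c x). Proof. by case: sA => -[_ _ _ + _] _; apply. Qed.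
Let AM x y : A x -> A y -> A (mul_op x y). Proof. by case: sA => -[_ _ _ _ +] _; apply. Qed.

Variables (psi : (H -> H) -> C) (kappa : R).
Hypothesis psi_lin : forall c x y, A x -> A y ->
  psi (add_op (scale_op c x) y) = c * psi x + psi y.
(* The case [T = 0] is the positivity of [psi], the others its boundedness. *)
Hypothesis psi_dom : forall x (T : R), A x -> 0 <= T ->
  (forall u, complex.Re (hip (x u) u) <= T * hnorm u ^+ 2) -> complex.Re (psi x) <= kappa * T.
Hypothesis algA : forall x, A x -> self_adjoint x -> algebraic x.

Let adjA x : A x -> exists2 y, A y & adj_of x y. Proof. by case: sA => _; apply. Qed.

Lemma psi0 : psi (@zero_op R H) = 0.
Proof.
have A0 : A (@zero_op R H) by case: sA => -[].
have := psi_lin (-1) A0 A0.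
have -> : add_op (scale_op (-1) (@zero_op R H)) (@zero_op R H) = @zero_op R H.
  by apply/funext => u; rewrite /add_op /scale_op /zero_op scaler0 addr0.
by rewrite mulN1r addNr.
Qed.

Lemma psiZ c x : A x -> psi (scale_op c x) = c * psi x.
Proof.
move=> Ax; have A0 : A (@zero_op R H) by case: sA => -[].
rewrite -[RHS]addr0 -psi0 -psi_lin //; congr psi.
by apply/funext => u; rewrite /add_op /zero_op addr0.
Qed.

Lemma psiD x y : A x -> A y -> psi (add_op x y) = psi x + psi y.
Proof.
move=> Ax Ay; rewrite -[psi x]mul1r -psi_lin //; congr psi.
by apply/funext => u; rewrite /add_op /scale_op scale1r.
Qed.

(** For real [t] the operator [i t x] has imaginary numerical range, so [psi_dom] with [T = 0]
    applies for both signs of [t]. *)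
Lemma psi_self_adjoint x : A x -> self_adjoint x -> complex.Im (psi x) = 0.
Proof.
move=> Ax sx.
have h (t : R) : complex.Re (psi (scale_op (Complex 0 t) x)) <= 0.
  rewrite -(mulr0 kappa); apply: psi_dom => //; first exact: AZ.
  move=> u; rewrite /scale_op (ipZl HP) mul0r; have := self_adjoint_Im u sx.
  by case: (hip (x u) u) => p q /= ->; lra.
have := h 1; have := h (-1); rewrite !psiZ //.
by case: (psi x) => p q /=; lra.
Qed.

(** Both [x + y] and [i (x - y)] are self-adjoint; their real values determine [psi y] from
    [psi x]. *)
Lemma psi_adj x y : A x -> A y -> adj_of x y -> psi y = conjc (psi x).
Proof.
move=> Ax Ay xy; have yx := adj_sym xy.
have s1 : self_adjoint (add_op x y).
  by move=> u v; rewrite /add_op (ipDl HP) (ipDr HP) xy yx addrC.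
have s2 : self_adjoint (add_op (scale_op 'i%C x) (scale_op (- 'i%C) y)).
  move=> u v; rewrite /add_op /scale_op (ipDl HP) (ipDr HP) !(ipZl HP) !(ipZr HP) xy yx.
  have i3 : conjc 'i%C = - 'i%C :> C by simpc.
  have i4 : conjc (- 'i%C) = 'i%C :> C by rewrite -i3 conjcK.
  by rewrite i3 i4 addrC.
have := psi_self_adjoint (AD Ax Ay) s1.
have := psi_self_adjoint (AD (AZ 'i%C Ax) (AZ (- 'i%C) Ay)) s2.
rewrite !psiD ?psiZ //; try exact: AZ.
case: (psi x) (psi y) => p q [p' q'] /= h1 h2; congr Complex; lra.
Qed.

Lemma psi_ge0 x y : A x -> A y -> adj_of x y -> 0 <= psi (mul_op y x).
Proof.
move=> Ax Ay xy; have Ayx := AM Ay Ax.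
rewrite lecE /= (psi_self_adjoint Ayx (adj_mul_self xy)) eqxx /=.
have : complex.Re (psi (scale_op (-1) (mul_op y x))) <= kappa * 0.
  apply: psi_dom => //; first exact: AZ.
  move=> u; rewrite /scale_op /mul_op (ipZl HP) mulN1r (adj_nrm_sqr u xy) ReN /= mul0r.
  by rewrite oppr_le0 sqr_ge0.
by rewrite psiZ // mulN1r ReN; lra.
Qed.

Definition adjf x : H -> H := xget (@zero_op R H) [set y | A y /\ adj_of x y]%classic.

Lemma adjfP x : A x -> A (adjf x) /\ adj_of x (adjf x).
Proof.
move=> Ax; have [y Ay xy] := adjA Ax.
by rewrite /adjf; case: xgetP => [z _ //|/(_ y)]; case.
Qed.

Lemma adjf_mem x : A x -> A (adjf x). Proof. by case/adjfP. Qed.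
Lemma adjf_adj x : A x -> adj_of x (adjf x). Proof. by case/adjfP. Qed.

Lemma adjfE x y : A x -> adj_of x y -> adjf x = y.
Proof. by move=> /adjf_adj h /(adj_unique h). Qed.

Definition gns_form (x y : V) : C := psi (mul_op (adjf \v y) \v x).

Lemma gns_form_semi : semi_inner gns_form.
Proof.
have Av (x : V) := submodP x.
split.
- move=> a u v w; have Aw := adjf_mem (Av w); rewrite /gns_form.
  rewrite -psi_lin; try by apply: AM.
  congr psi; apply/funext => z; have lw := (bA Aw).1.
  by rewrite /mul_op submod_val_lin; apply: lw.
- move=> u v; rewrite /gns_form; apply: psi_adj.
  + by apply: AM => //; apply: adjf_mem.
  + by apply: AM => //; apply: adjf_mem.
  + by apply: adj_mul; [apply: adj_sym|]; apply: adjf_adj.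
- by move=> u; apply: psi_ge0 => //; [apply: adjf_mem | apply: adjf_adj].
Qed.

Let nrm := hnorm_of gns_form.

(** Total, with value 0 off [A], because representations are functions on all maps [H -> H]. *)
Definition in_alg x : V :=
  if pselect (A x) is left Ax then to_submod subalg_submod Ax else 0.

Lemma in_algK x : A x -> \v (in_alg x) = x.
Proof. by rewrite /in_alg; case: pselect. Qed.

Lemma in_alg_val (y : V) : in_alg \v y = y.
Proof. by apply: submod_val_inj; rewrite in_algK //; apply: submodP. Qed.

Definition lmul x (y : V) : V := in_alg (mul_op x \v y).

Lemma lmulE x y : A x -> \v (lmul x y) = mul_op x \v y.
Proof. by move=> Ax; rewrite in_algK //; apply: AM => //; apply: submodP. Qed.

Lemma lmul_lin x c y z : A x -> lmul x (c *: y + z) = c *: lmul x y + lmul x z.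
Proof.
move=> Ax; apply: submod_val_inj; rewrite submod_val_lin !lmulE //.
by apply/funext => u; rewrite /mul_op submod_val_lin; apply: (bA Ax).1.
Qed.

(** With [M = opnorm x], the operator [(x y)' (x y) - M^2 y' y] has nonpositive numerical range,
    which is [psi_dom] for [T = 0]. *)
Lemma lmul_bound x y : A x -> nrm (lmul x y) <= opnorm x * nrm y.
Proof.
move=> Ax; have bx := bA Ax; have Ay := submodP y; have Axy := AM Ax Ay.
rewrite -ler_sqr ?nnegrE ?mulr_ge0 ?opnorm_ge0 ?nrm_ge0 // exprMn !(nrm_sqr gns_form_semi).
rewrite /gns_form lmulE //; have ay := adjf_adj Ay; have axy := adjf_adj Axy.
have A1 : A (mul_op (adjf (mul_op x \v y)) (mul_op x \v y)).
  by apply: AM => //; apply: adjf_mem.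
have A2 : A (mul_op (adjf \v y) \v y) by apply: AM => //; apply: adjf_mem.
have : complex.Re (psi (add_op (scale_op (- (opnorm x ^+ 2)%:C) (mul_op (adjf \v y) \v y))
    (mul_op (adjf (mul_op x \v y)) (mul_op x \v y)))) <= kappa * 0.
  apply: psi_dom => //; first by apply: AD => //; apply: AZ.
  move=> u; rewrite mul0r /add_op /scale_op (ipDl HP) (ipZl HP) /mul_op.
  rewrite (adj_nrm_sqr u ay) (adj_nrm_sqr u axy) mulNr ReD ReN ReMr /= /mul_op addrC subr_le0.
  by rewrite -exprMn ler_sqr ?nnegrE ?mulr_ge0 ?opnorm_ge0 ?hnorm_ge0 // opnorm_bound.
by rewrite psi_lin // mulNr ReD ReN ReMr mulr0 addrC subr_le0.
Qed.

Local Notation K2 := (dual_hilbert gns_form_semi).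
Local Notation D := (dual gns_form).

Lemma pi_antilinear x (xi : D) : A x ->
  bounded_antilinear gns_form (fun y => dapp xi (lmul (adjf x) y)).
Proof.
move=> Ax; have Aa := adjf_mem Ax; split=> [c y z|]; first by rewrite lmul_lin // dappD.
have [K K0 hK] := dapp_bound xi.
exists (K * opnorm (adjf x)) => [|y]; first by rewrite mulr_ge0 ?opnorm_ge0 //; apply: bA.
by apply: le_trans (hK _) _; rewrite -mulrA ler_wpM2l // lmul_bound.
Qed.

Definition gns_rep x (xi : D) : D :=
  if pselect (A x) is left Ax
  then to_submod (bounded_antilinear_submod gns_form) (pi_antilinear xi Ax) else 0.

Lemma gns_repE x xi y : A x -> dapp (gns_rep x xi) y = dapp xi (lmul (adjf x) y).
Proof. by move=> Ax; rewrite /gns_rep; case: pselect. Qed.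

Lemma gns_rep_dual_of x z : A x -> gns_rep x (dual_of gns_form_semi z) = dual_of gns_form_semi (lmul x z).
Proof.
move=> Ax; apply: dapp_ext => y; rewrite gns_repE // !dual_ofE /gns_form.
have Ay := submodP y; have Aa := adjf_mem Ax.
rewrite !lmulE //; congr psi; apply/funext => u; rewrite /mul_op.
suff -> : adjf (mul_op (adjf x) \v y) = mul_op (adjf \v y) x by [].
apply: adjfE; first exact: AM.
by apply: adj_mul; [apply: adj_sym|]; apply: adjf_adj.
Qed.

Lemma gns_rep_lin x c (xi eta : D) : A x ->
  gns_rep x (c *: xi + eta) = c *: gns_rep x xi + gns_rep x eta.
Proof. by move=> Ax; apply: dapp_ext => y; rewrite dapp_lin !gns_repE. Qed.

Lemma gns_rep_bound x (xi : K2) : A x -> hnorm (gns_rep x xi : K2) <= opnorm (adjf x) * hnorm xi.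
Proof.
move=> Ax; have Aa := adjf_mem Ax; have o0 := opnorm_ge0 (bA Aa).
apply: (dnrm_le gns_form_semi); first by rewrite mulr_ge0 // hnorm_ge0.
move=> y; rewrite gns_repE //; apply: le_trans (dapp_le_dnrm gns_form_semi _ _) _.
rewrite [leRHS]mulrAC [leRHS]mulrC; apply: ler_wpM2l; first exact: nrm_ge0.
exact: lmul_bound.
Qed.

Lemma gns_rep_bop x : A x -> bop (gns_rep x : K2 -> K2).
Proof.
move=> Ax; split; first by move=> c xi eta; apply: gns_rep_lin.
by exists (opnorm (adjf x)) => xi; apply: gns_rep_bound.
Qed.

(** On vectors [dual_of z] this is the reproducing property; density and boundedness of both sides
    in [eta] do the rest. *)
Lemma gns_rep_adj x y : A x -> A y -> adj_of x y ->
  adj_of (gns_rep x : K2 -> K2) (gns_rep y : K2 -> K2).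
Proof.
move=> Ax Ay xy xi eta; have KP := hilbert_semi K2.
have bx := gns_rep_bop Ax; have by_ := gns_rep_bop Ay.
have dense z : hip (gns_rep x xi : K2) (dual_of gns_form_semi z : K2) =
    hip xi (gns_rep y (dual_of gns_form_semi z) : K2).
  rewrite gns_rep_dual_of // [LHS](dip_dual_of gns_form_semi) [RHS](dip_dual_of gns_form_semi).
  by rewrite gns_repE // (adjfE Ax xy).
apply/eqP; rewrite -subr_eq0; apply/eqP/ComplexField.Normc.eq0_normc.
apply/eqP; rewrite eq_le normc_ge0 andbT leNgt; apply/negP => h.
set K := hnorm (gns_rep x xi : K2) + hnorm xi * opnorm (gns_rep y : K2 -> K2).
have K0 : 0 <= K by rewrite addr_ge0 ?mulr_ge0 ?hnorm_ge0 ?opnorm_ge0.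
have K1 : 0 < K + 1 by rewrite ltr_wpDl.
have [z hz] := dual_of_dense gns_form_semi eta (divr_gt0 h K1).
set d := (eta : K2) - (dual_of gns_form_semi z : K2).
have dn : hnorm d < normc (hip (gns_rep x xi : K2) eta - hip xi (gns_rep y eta : K2)) / (K + 1).
  by rewrite /d -hnormN opprB.
have dE : hip (gns_rep x xi : K2) eta - hip xi (gns_rep y eta : K2) =
   hip (gns_rep x xi : K2) d - hip xi (gns_rep y d : K2).
  by rewrite /d (linB by_.1) !(ipBr KP) dense opprB addrA subrK.
move: dn; rewrite ltr_pdivlMr //; apply/negP; rewrite -leNgt dE.
apply: le_trans (le_normcD _ _) _; rewrite normcN.
apply: le_trans (_ : hnorm d * K <= _); last by rewrite ler_wpM2l ?hnorm_ge0 // lerDl.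
rewrite [hnorm d * K]mulrC mulrDl; apply: lerD; first exact: (cauchy_schwarz KP).
apply: le_trans (cauchy_schwarz KP _ _) _.
by rewrite -mulrA ler_wpM2l ?hnorm_ge0 //; apply: opnorm_bound.
Qed.

Lemma gns_rep_star_hom : @star_hom R H K2 A gns_rep.
Proof.
split.
- by move=> x Ax; apply: gns_rep_bop.
- move=> x y Ax Ay; apply/funext => xi; apply: dapp_ext => z.
  rewrite gns_repE; last exact: AD.
  have -> : lmul (adjf (add_op x y)) z = lmul (adjf x) z + lmul (adjf y) z.
    apply: submod_val_inj; have E : adjf (add_op x y) = add_op (adjf x) (adjf y).
      by apply: adjfE; [apply: AD | apply: adj_add; apply: adjf_adj].
    rewrite lmulE; last by apply/adjf_mem/AD.
    rewrite -[lmul (adjf x) z]scale1r submod_val_lin scale1r !lmulE ?E //; exact: adjf_mem.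
  rewrite -[lmul (adjf x) z]scale1r dappD conjc1 mul1r -!gns_repE //.
- move=> c x Ax; apply/funext => xi; apply: dapp_ext => z.
  have Acx := AZ c Ax; rewrite gns_repE //.
  have -> : lmul (adjf (scale_op c x)) z = conjc c *: lmul (adjf x) z + 0.
    apply: submod_val_inj; have E : adjf (scale_op c x) = scale_op (conjc c) (adjf x).
      by apply: adjfE => //; apply/adj_scale/adjf_adj.
    by rewrite submod_val_lin !lmulE ?E ?addr0 //; [apply: adjf_mem | apply/AZ/adjf_mem].
  rewrite dappD conjcK dapp0r addr0 -(gns_repE _ _ Ax).
  by symmetry; apply: dappZl.
- move=> x y Ax Ay; apply/funext => xi; apply: dapp_ext => z.
  have Axy := AM Ax Ay; rewrite /mul_op !gns_repE //; congr dapp.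
  apply: submod_val_inj; have E : adjf (mul_op x y) = mul_op (adjf y) (adjf x).
    by apply: adjfE => //; apply: adj_mul; apply: adjf_adj.
  have Ax' := adjf_mem Ax; have Ay' := adjf_mem Ay.
  by rewrite lmulE ?E; [rewrite !lmulE | apply: AM].
- by move=> x y Ax Ay xy; apply: gns_rep_adj.
Qed.

(** Without a unit, the cyclic vector is the functional sending [y] to the conjugate of [psi y]; the
    point is that it is bounded. *)
Lemma gns : exists (K : hilbert R) (pi0 : (H -> H) -> (K -> K)) (w : K),
  [/\ star_hom A pi0, cyclic_vec A pi0 w & forall x, A x -> psi x = hip (pi0 x w) w].
Proof.
(* With a left unit [e] of [y], [psi y] is [gns_form y e], so Cauchy-Schwarz leaves [psi (e e)], at
   most [kappa] since [e] is a contraction. *)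
have psi_bound (y : V) : normc (psi \v y) <= Num.sqrt kappa * nrm y.
  have Ay := submodP y; have Ay' := adjf_mem Ay; have ay := adjf_adj Ay.
  have alg : algebraic (mul_op \v y (adjf \v y)).
    by apply: algA; [apply: AM | apply: adj_mul_self; apply: adj_sym].
  have [e [Ae se ey en]] := algebraic_left_unit sA Ay Ay' ay alg.
  have aE : adjf e = e by apply: adjfE.
  have -> : psi \v y = gns_form y (in_alg e) by rewrite /gns_form in_algK // aE ey.
  apply: le_trans (cauchy_schwarz gns_form_semi _ _) _.
  rewrite mulrC ler_wpM2r ?nrm_ge0 //; apply: ler_wsqrtr.
  rewrite /gns_form in_algK // aE -[kappa]mulr1; apply: psi_dom => // [|u]; first exact: AM.
  by rewrite (adj_nrm_sqr u se) mul1r /= ler_sqr ?nnegrE ?hnorm_ge0.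
have wP : bounded_antilinear gns_form (fun y => conjc (psi \v y)).
  split=> [c x y|]; last first.
    by exists (Num.sqrt kappa) => [|y]; [apply: sqrtr_ge0 | rewrite normc_conj; apply: psi_bound].
  rewrite submod_val_lin -rmorphM -rmorphD /=; congr conjc.
  by apply: psi_lin; apply: submodP.
pose w : D := to_submod (bounded_antilinear_submod gns_form) wP.
(* The orbit of [w] is the dense image of [A], and pairing it with [w] returns [psi]. *)
have repw x : A x -> gns_rep x w = dual_of gns_form_semi (in_alg x).
  move=> Ax; apply: dapp_ext => y; rewrite gns_repE // dual_ofE /gns_form in_algK //.
  have Ay := submodP y; have Ax' := adjf_mem Ax; have Ay' := adjf_mem Ay.
  rewrite [LHS](_ : _ = conjc (psi \v (lmul (adjf x) y))) // lmulE //.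
  symmetry; apply: psi_adj; try exact: AM.
  by apply: adj_mul; [apply: adj_sym|]; apply: adjf_adj.
exists K2, gns_rep, w; split; first exact: gns_rep_star_hom.
  move=> xi e e0; have [x hx] := dual_of_dense gns_form_semi xi e0.
  by exists \v x; [apply: submodP | rewrite repw ?in_alg_val //; apply: submodP].
move=> x Ax; rewrite repw // (ipC (hilbert_semi K2)) [X in conjc X](dip_dual_of gns_form_semi w).
rewrite [X in conjc X](_ : _ = conjc (psi \v (in_alg x))) //.
by rewrite in_algK // conjcK.
Qed.

End GNS.

(** * Extension of functionals *)

Section RealScalars.
Variables (R : realType) (W : lmodType (complex R)).

(** A separate name, so that the real module structure does not compete with the complex one. *)
Definition realified : Type := W.
HB.instance Definition _ := GRing.Zmodule.on realified.

Definition real_scale (t : R) (x : realified) : realified := (t%:C *: (x : W) : W).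

Fact real_scaleA a b x : real_scale a (real_scale b x) = real_scale (a * b) x.
Proof. by rewrite /real_scale scalerA -rmorphM. Qed.
Fact real_scale1 : left_id 1 real_scale.
Proof. by move=> x; apply: scale1r. Qed.
Fact real_scaleDr : right_distributive real_scale +%R.
Proof. by move=> a x y; apply: scalerDr. Qed.
Fact real_scaleDl x : {morph real_scale^~ x : a b / a + b}.
Proof. by move=> a b; rewrite /real_scale rmorphD; apply: scalerDl. Qed.

HB.instance Definition _ := GRing.Zmodule_isLmodule.Build R realified
  real_scaleA real_scale1 real_scaleDr real_scaleDl.

End RealScalars.

(** * The upper numerical bound, a sublinear functional *)

Section NumericalBound.
Variables (R : realType) (H : hilbert R).
Local Notation C := (complex R).
Local Notation nrm := (@hnorm R H).
Let HP := hilbert_semi H.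
Implicit Types x y : H -> H.

(** The positive part of the supremum of the real numerical range. The constraint [0 <= T] provides
    the square root of [T] used in [star_hom_numbound]. *)
Definition numbound x : R :=
  inf [set T | 0 <= T /\ forall u, complex.Re (hip (x u) u) <= T * nrm u ^+ 2]%classic.

Lemma numbound_nonempty x : bop x ->
  ([set T | 0 <= T /\ forall u, complex.Re (hip (x u) u) <= T * nrm u ^+ 2] !=set0)%classic.
Proof.
move=> bx; exists (opnorm x); split; first exact: opnorm_ge0.
move=> u; apply: le_trans (Re_cauchy_schwarz HP _ _) _.
by rewrite expr2 mulrA ler_wpM2r ?nrm_ge0 //; apply: opnorm_bound.
Qed.

Lemma numbound_le x (T : R) : 0 <= T ->
  (forall u, complex.Re (hip (x u) u) <= T * nrm u ^+ 2) -> numbound x <= T.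
Proof. by move=> T0 hT; apply: ge_inf => //; exists 0 => z []. Qed.

Lemma numbound_ge0 x : bop x -> 0 <= numbound x.
Proof. by move=> bx; apply: lb_le_inf => [|z []//]; apply: numbound_nonempty. Qed.

Lemma numboundP x u : bop x -> complex.Re (hip (x u) u) <= numbound x * nrm u ^+ 2.
Proof.
move=> bx; have [->|u0] := pselect (u = 0).
  by rewrite (ip0r HP) hnorm0 expr0n mulr0.
have n2 : 0 < nrm u ^+ 2 by rewrite exprn_gt0 // hnorm_gt0.
rewrite -ler_pdivrMr //; apply: lb_le_inf; first exact: numbound_nonempty.
by move=> T [_ hT]; rewrite ler_pdivrMr.
Qed.

Lemma numboundD x y : bop x -> bop y -> numbound (add_op x y) <= numbound x + numbound y.
Proof.
move=> bx by_; apply: numbound_le => [|u]; first by rewrite addr_ge0 ?numbound_ge0.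
by rewrite /add_op (ipDl HP) ReD mulrDl lerD // numboundP.
Qed.

Lemma numboundZ x (t : R) : bop x -> 0 <= t -> numbound (scale_op t%:C x) = t * numbound x.
Proof.
have le s z : bop z -> 0 <= s -> numbound (scale_op s%:C z) <= s * numbound z.
  move=> bz s0; apply: numbound_le => [|u]; first by rewrite mulr_ge0 ?numbound_ge0.
  by rewrite /scale_op (ipZl HP) ReMr -mulrA ler_wpM2l // numboundP.
move=> bx t0; apply/eqP; rewrite eq_le le //=.
have [->|tn0] := eqVneq t 0; first by rewrite mul0r numbound_ge0 //; apply: bop_scale.
have tp : 0 < t by rewrite lt_neqAle eq_sym tn0.
rewrite mulrC -ler_pdivlMr // mulrC.
have {1}-> : x = scale_op t^-1%:C (scale_op t%:C x).
  by apply/funext => u; rewrite /scale_op scalerA -rmorphM mulVf // scale1r.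
by apply: le; [apply: bop_scale | rewrite invr_ge0].
Qed.

End NumericalBound.

Section Extension.
Variables (R : realType) (H : hilbert R) (A : (H -> H) -> Prop).
Local Notation C := (complex R).
Let HP := hilbert_semi H.
Hypothesis sA : star_subalg A.
Hypothesis algA : forall x, A x -> self_adjoint x -> algebraic x.

(** After replacing [x] by its real part [z], write [z = - (2 r h + h^2)] with [r = sqrt T]. Then |r
    v + pi(h) v|^2 >= 0 is the claim, with [r v] doing the work of the absent identity of [B]. *)
Lemma star_hom_numbound (B : (H -> H) -> Prop) (K : hilbert R)
    (pi : (H -> H) -> (K -> K)) (v : K) x :
  star_subalg B -> (forall x, B x -> A x) -> star_hom B pi -> B x ->
  complex.Re (hip (pi x v) v) <= hnorm v ^+ 2 * numbound x.
Proof.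
move=> sB BA [pib piD piZ piM pis] Bx.
have KP := hilbert_semi K; have [[bB _ BD BZ BM] Bs] := sB.
have [y By xy] := Bs x Bx; have yx := adj_sym xy.
pose z := scale_op (2^-1)%:C (add_op x y).
have Bz : B z by apply/BZ/BD.
have sz : self_adjoint z.
  move=> u w; rewrite /z /scale_op /add_op (ipZl HP) (ipZr HP) conjc_real.
  by rewrite (ipDl HP) (ipDr HP) xy yx addrC.
have zx u : complex.Re (hip (z u) u) = complex.Re (hip (x u) u).
  rewrite /z /scale_op /add_op (ipZl HP) ReMr (ipDl HP) ReD yx (Re_ipC HP u).
  by field.
have T0 := numbound_ge0 (bB _ Bx); set T := numbound x in T0 *.
have [|h [Bh sh _ hE]] := algebraic_sqrt_shift sB Bz sz (algA (BA _ Bz) sz) T0.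
  by move=> u; rewrite zx; apply/numboundP/bB.
set r := Num.sqrt T in hE.
have r2 : r ^+ 2 = T by rewrite sqr_sqrtr.
have shp : self_adjoint (pi h) by apply: (pis h h).
have pzE : complex.Re (hip (pi z v) v) = complex.Re (hip (pi x v) v).
  rewrite /z (piZ _ _ (BD _ _ Bx By)) (piD _ _ Bx By).
  rewrite /scale_op /add_op (ipZl KP) ReMr (ipDl KP) ReD.
  rewrite (adj_sym (pis _ _ Bx By xy)) (Re_ipC KP v); by field.
clearbody z.
have zE : z = scale_op (-1) (add_op (scale_op (2 * r)%:C h) (mul_op h h)).
  by apply/funext => u; rewrite hE /scale_op /add_op scaleN1r.
have B1 : B (scale_op (2 * r)%:C h) by apply: BZ.
have B2 : B (mul_op h h) by apply: BM.
rewrite -pzE zE (piZ _ _ (BD _ _ B1 B2)) (piD _ _ B1 B2) (piZ _ _ Bh) (piM _ _ Bh Bh).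
rewrite /scale_op /add_op /mul_op (ipZl KP) mulN1r ReN (ipDl KP) ReD (ipZl KP) ReMr.
rewrite (adj_nrm_sqr v shp) /=.
have := sqr_ge0 (hnorm (r%:C *: v + pi h v)).
rewrite /hnorm (nrm_sqrD KP) (nrmZ KP) exprMn normc_real real_normK ?num_real // r2.
rewrite (ipZl KP) ReMr (Re_ipC KP v); lra.
Qed.

Lemma algebraic_Estar : property_Estar A.
Proof.
move=> B sB BA K pi v hpi _; have KP := hilbert_semi K.
have [pib piD piZ piM pis] := hpi.
have [[bA _ AD AZ AM] _] := sA; have [[bB B0 BD BZ BM] Bs] := sB.
pose V := submod (subalg_submod sA).
pose valV (x : realified V) : H -> H := submod_val (x : V).
have AV (x : realified V) : A (valV x) by apply: submodP.
have bV (x : realified V) : bop (valV x) by apply: bA.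
set kappa := hnorm v ^+ 2; have k0 : 0 <= kappa by apply: sqr_ge0.
have piL c x y : B x -> B y -> pi (add_op (scale_op c x) y) v = c *: pi x v + pi y v.
  by move=> Bx By; rewrite piD ?piZ //; apply: BZ.
pose maj (x : realified V) : R := kappa * numbound (valV x).
have pS (x y : realified V) : maj (x + y) <= maj x + maj y.
  by rewrite -mulrDr ler_wpM2l //; apply: numboundD (bV x) (bV y).
have pH (t : R) (x : realified V) : 0 <= t -> maj (t *: x) = t * maj x.
  by move=> t0; rewrite /maj mulrCA -(numboundZ (bV x) t0).
have [|||g [gL gp gF]] := @hahn_banach R (realified V) maj pS pH
    [set x | B (valV x)]%classic (fun x => complex.Re (hip (pi (valV x) v) v)).
- exact: B0.
- move=> t x y Bx By; split; first by apply: BD => //; apply: BZ.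
  rewrite [pi _ v](piL t%:C (valV x) (valV y) Bx By).
  by rewrite (ipDl KP) (ipZl KP) ReD ReMr.
- by move=> x Bx; apply: star_hom_numbound Bx.
pose inV x : V := in_alg sA x.
have inVK x : A x -> valV (inV x) = x by apply: in_algK.
(* The complex-linear functional with real part [g], recovered as [g(x) - i g(i x)]. *)
pose psi x : C := Complex (g (inV x)) (- g ('i%C *: inV x)).
have gZ (p q : R) (x y : V) : g (Complex p q *: x + y) = p * g x + q * g ('i%C *: x) + g y.
  have -> : Complex p q *: x + y = p%:C *: x + (q%:C *: ('i%C *: x) + y).
    rewrite scalerA addrA -scalerDl; congr (_ *: _ + _); simpc.
    by [].
  by rewrite [LHS]gL [g (_ + y)]gL addrA.
have inL c x y : A x -> A y -> inV (add_op (scale_op c x) y) = c *: inV x + inV y.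
  move=> Ax Ay; apply: submod_val_inj; rewrite submod_val_lin !in_algK //.
  by apply: AD => //; apply: AZ.
have psiL c x y : A x -> A y -> psi (add_op (scale_op c x) y) = c * psi x + psi y.
  move=> Ax Ay; rewrite /psi inL //; case: c => p q.
  have -> : 'i%C *: (Complex p q *: inV x + inV y) =
      Complex (- q) p *: inV x + 'i%C *: inV y.
    by rewrite scalerDr scalerA; congr (_ *: _ + _); simpc.
  rewrite !gZ; simpc; congr Complex; ring.
have psid x (T : R) : A x -> 0 <= T ->
    (forall u, complex.Re (hip (x u) u) <= T * hnorm u ^+ 2) ->
    complex.Re (psi x) <= kappa * T.
  move=> Ax T0 hT; apply: le_trans (gp (inV x)) _; rewrite ler_wpM2l //.
  by rewrite /= inVK //; apply: numbound_le.
have [K2 [pi0 [w [h1 h2 h3]]]] := gns sA psiL psid algA.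
exists K2, pi0, w; split=> // x Bx; rewrite -h3; last exact: BA.
have Ax := BA _ Bx.
have e1 : g (inV x) = complex.Re (hip (pi x v) v).
  by rewrite gF /= inVK.
(* [B] is a complex subspace, so agreement of real parts at [i x] gives that of imaginary parts at
   [x]. *)
have e2 : g ('i%C *: inV x) = - complex.Im (hip (pi x v) v).
  have ix : valV ('i%C *: inV x) = scale_op 'i%C x by rewrite -{2}(inVK x Ax).
  have Bix : B (valV ('i%C *: inV x)) by rewrite ix; apply: BZ.
  by rewrite (gF _ Bix) ix piZ // /scale_op (ipZl KP); case: (hip _ _) => q r /=; lra.
by rewrite /psi e1 e2 opprK; case: (hip _ _).
Qed.

End Extension.

Theorem theorem2p12 (R : realType) (H : hilbert R) (A : (H -> H) -> Prop) :
  star_subalg A ->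
  [<-> (* (1) *) (forall x, A x -> self_adjoint x -> finite_spectrum x);
       (* (1') *) (forall x, A x -> exists2 y, A y & mul_op (mul_op x y) x = x);
       (* (2) *) (forall B, star_subalg B -> (forall x, B x -> A x) ->
                    unique_cstar_norm B);
       (* (3) *) (forall a, A a -> positive_op a ->
                    unique_cstar_norm (gen_subalg a));
       (* (4) *) property_Estar A].
Proof.
move=> sA; have [[bA _ _ _ AM] As] := sA.
tfae.
- move=> fin x Ax; have [x' Ax' xx'] := As x Ax.
  have Aa : A (mul_op x' x) by apply: AM.
  have sa := adj_mul_self xx'.
  apply: algebraic_regular xx' _ => //.
  by apply: finite_spectrum_algebraic; [apply: bA | | apply: fin].
- move=> reg B sB BA; apply: algebraic_unique_cstar_norm => // a Ba sa.
  exact: (regular_algebraic sA (BA _ Ba) sa reg).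
- move=> uniq a Aa pa; have ba := bA _ Aa.
  have sa := positive_self_adjoint ba pa.
  apply: uniq; first exact: gen_subalg_star.
  by move=> x; apply=> //; case: sA.
- move=> uniq; apply: algebraic_Estar => // a Aa sa; have ba := bA _ Aa.
  apply: algebraic_sqr => //; apply: contrapT => nalg.
  have Aaa : A (mul_op a a) by apply: AM.
  apply: (transcendental_not_unique _ _ nalg); [exact: bA | exact: adj_mul_self |].
  by apply: uniq => //; apply: mul_self_positive.
- move=> hE x Ax sx; apply: algebraic_finite_spectrum; first exact: bA.
  exact: (Estar_algebraic sA hE Ax sx).
Qed.
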